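(* Let $\rho_0,\rho_1$ be separable states on a finite-dimensional bipartite system $AB$ (i.e. $\rho_0,\rho_1\in\mathrm{SEP}$). Then $$R_{\mathrm m}(\rho_0,\rho_1)=R_{\mathrm c}(\rho_0,\rho_1)=P_{\mathrm{LOCC}}(\rho_0,\rho_1).$$ That is, neither an entangled catalyst nor a reusable quantum memory can increase the optimal success rate of local discrimination of two separable states beyond the optimal LOCC success probability.
   Context: All systems are finite-dimensional. A bipartite state $\rho^{AB}$ is separable if $\rho^{AB}=\sum_x p_x\,\psi_x^A\otimes\phi_x^B$ for a probability distribution $\{p_x\}$ and pure states $\psi_x^A,\phi_x^B$; $\mathrm{SEP}$ denotes the set of separable states. LOCC denotes local operations and classical communication between Alice (holding all systems labelled $A,A',\dots$) and Bob (holding $B,B',\dots$). An LOCC measurement channel is a map $\mathcal M(X)=\sum_i \mathrm{Tr}[M_iX]\,|ii\rangle\langle ii|$ where $\{M_i\}$ is a POVM implementable by an LOCC protocol. The LOCC norm is $\|X\|_{\mathrm{LOCC}}=\sup_{\mathcal M}\|\mathcal M(X)\|_1$ (supremum over LOCC measurement channels), and $P_{\mathrm{LOCC}}(\rho_0,\rho_1)=\tfrac12+\tfrac14\|\rho_0-\rho_1\|_{\mathrm{LOCC}}$ is the optimal LOCC success probability for discriminating $\rho_0,\rho_1$ given with equal priors. Also $P_{\mathrm{opt}}(\rho_0,\rho_1)=\tfrac12+\tfrac14\|\rho_0-\rho_1\|_1$. Repeated discrimination framework: $Z_1,Z_2,\dots$ are i.i.d. uniform on $\{0,1\}$; in round $j$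 Alice and Bob receive $\rho^{AB}_{Z_j}$ and output a guess $Y_j\in\{0,1\}$; $X_j=1$ if $Y_j=Z_j$ and $X_j=0$ otherwise; $S_n=\sum_{j=1}^n X_j$. A rate $r\in[0,1]$ is achievable by a protocol if for every $\varepsilon>0$ and every $m>0$ there exists $n\ge m$ with $\Pr(S_n\ge rn)\ge 1-\varepsilon$. Memory-assisted protocols: Alice and Bob share an auxiliary finite-dimensional system $A'B'$ (the memory) initially in some state $\mu_1^{A'B'}$. In round $j$ they apply an LOCC protocol (which may depend on all classical outcomes they obtained in earlier rounds, but not on the $Z$'s) to $\rho_{Z_j}^{AB}\otimes\mu_j^{A'B'}$, producing the guess $Y_j$ and leaving the memory in a (outcome-dependent) state $\mu_{j+1}^{A'B'}$ used in the next round. $R_{\mathrm m}(\rho_0,\rho_1)$ is the supremum of achievable rates over all memory dimensions, initial memory states and such protocols. Catalytic protocols: Alice and Bob share a catalyst state $\tau^{A'B'}$ and use an LOCC channel $\Lambda$ on $AA'|BB'$ satisfying $\Lambda(\rho_i^{AB}\otimes\tau^{A'B'})=\sigma_i^{AB}\otimes\tau^{A'B'}$ for $i=0,1$ (for some states $\sigma_0,\sigma_1$), followed by an LOCC measurement on $AB$ producing the guess; in each round the same procedure is applied with the returned catalyst. $R_{\mathrm c}(\rho_0,\rho_1)$ is the supremum of achievable rates over all such catalysts $\tau$, channels $\Lambda$ and LOCC measurements. *)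

(* Defs.v *)
(* Finite-dimensional quantum systems are modelled by
   finite types (the index set of an orthonormal basis); operators on a
   system T (resp. from T to S) are functions T -> T -> C (resp. S -> T -> C),
   i.e. matrices indexed by finite types, with C = R[i], R : realType. *)
From HB Require Import structures.
From mathcomp Require Import all_boot all_order all_algebra.
From mathcomp Require Import complex.
From mathcomp Require Import classical_sets reals.

Set Implicit Arguments.
Unset Strict Implicit.
Unset Printing Implicit Defensive.

Import Order.TTheory GRing.Theory Num.Theory.
Local Open Scope ring_scope.

Section Quantum.
Variable R : realType.
Local Notation C := (R[i]).

Definition Op (S T : finType) := S -> T -> C.
Arguments Op (S T)%_type.

Definition tr (T : finType) (X : Op T T) : C := \sum_(t : T) X t t.

(* positive semidefinite: <v, X v> >= 0 for all vectors v
   (in the complex order: real and nonnegative) *)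
Definition psd (T : finType) (X : Op T T) : Prop :=
  forall v : T -> C, 0 <= \sum_(i : T) \sum_(j : T) conjc (v i) * X i j * v j.

Definition density (T : finType) (X : Op T T) : Prop := psd X /\ tr X = 1.

Definition separable (A B : finType) (rho : Op (A * B) (A * B)) : Prop :=
  exists (n : nat) (p : 'I_n -> R) (psi : 'I_n -> A -> C) (phi : 'I_n -> B -> C),
    [/\ (forall x, 0 <= p x), \sum_(x < n) p x = 1,
        (forall x, \sum_(a : A) conjc (psi x a) * psi x a = 1),
        (forall x, \sum_(b : B) conjc (phi x b) * phi x b = 1) &
        forall i j : A * B, rho i j =
          \sum_(x < n) (real_complex R (p x)) * (psi x i.1 * conjc (psi x j.1))
                                   * (phi x i.2 * conjc (phi x j.2))].

(* Local Kraus actions: Alice applies the Kraus operators Ks : A -> A' to her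
   system (tensored with the identity on Bob's), and symmetrically for Bob. *)
Definition actA (A B A' : finType) (Ks : seq (Op A' A)) (X : Op (A * B) (A * B))
  : Op (A' * B) (A' * B) :=
  fun i j => \sum_(K <- Ks) \sum_(x : A) \sum_(y : A)
               K i.1 x * X (x, i.2) (y, j.2) * conjc (K j.1 y).

Definition actB (A B B' : finType) (Ks : seq (Op B' B)) (X : Op (A * B) (A * B))
  : Op (A * B') (A * B') :=
  fun i j => \sum_(K <- Ks) \sum_(x : B) \sum_(y : B)
               K i.2 x * X (i.1, x) (j.1, y) * conjc (K j.2 y).

(* Finite-round LOCC protocols.  [proto L FA FB A B]: current local systems
   A (Alice) and B (Bob); final local systems FA, FB; leaves labelled in L.
   In a step, one party performs a local instrument: a list of branches,
   each branch = (Kraus operators of the branch's CP map, continuation);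
   the branch index is broadcast, so the continuation may depend on it. *)
Inductive proto (L : Type) (FA FB : finType) : finType -> finType -> Type :=
| Stop : L -> proto L FA FB FA FB
| AStep : forall (A B A' : finType),
    seq (seq (Op A' A) * proto L FA FB A' B) -> proto L FA FB A B
| BStep : forall (A B B' : finType),
    seq (seq (Op B' B) * proto L FA FB A B') -> proto L FA FB A B.

Arguments proto L%_type (FA FB _ _)%_type.
Arguments Stop {L FA FB}.
Arguments AStep {L FA FB A B A'}.
Arguments BStep {L FA FB A B B'}.

Fixpoint leaves L FA FB A B (p : proto L FA FB A B) {struct p}
  : seq (L * (Op (A * B) (A * B) -> Op (FA * FB) (FA * FB))) :=
  match p in proto _ _ _ A B
        return seq (L * (Op (A * B) (A * B) -> Op (FA * FB) (FA * FB))) with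
  | Stop l => [:: (l, id)]
  | AStep A B A' brs =>
      flatten (map (fun br => let '(Ks, q) := br in
                 map (fun lf => (lf.1, lf.2 \o actA Ks)) (leaves q)) brs)
  | BStep A B B' brs =>
      flatten (map (fun br => let '(Ks, q) := br in
                 map (fun lf => (lf.1, lf.2 \o actB Ks)) (leaves q)) brs)
  end.

Definition tp_loc (S T : finType) (Kss : seq (seq (Op S T))) : Prop :=
  forall x y : T,
    \sum_(Ks <- Kss) \sum_(K <- Ks) \sum_(s : S) conjc (K s x) * K s y
    = (x == y)%:R.

Fixpoint wf L FA FB A B (p : proto L FA FB A B) {struct p} : Prop :=
  match p with
  | Stop _ => True
  | AStep A B A' brs =>
      tp_loc (map fst brs) /\
      (fix go (l : seq (seq (Op A' A) * proto L FA FB A' B)) : Prop :=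
         match l with [::] => True | (_, q) :: l' => wf q /\ go l' end) brs
  | BStep A B B' brs =>
      tp_loc (map fst brs) /\
      (fix go (l : seq (seq (Op B' B) * proto L FA FB A B')) : Prop :=
         match l with [::] => True | (_, q) :: l' => wf q /\ go l' end) brs
  end.

(* || M(X) ||_1 = sum_i |Tr[M_i X]| for the LOCC measurement given by a
   well-formed protocol whose leaves are labelled by outcomes i : nat
   (the final local systems are discarded). *)
Definition meas_norm (A B FA FB : finType) (p : proto nat FA FB A B)
  (X : Op (A * B) (A * B)) : R :=
  \sum_(i <- undup (map fst (leaves p)))
     Normc.normc (\sum_(lf <- leaves p | lf.1 == i) tr (lf.2 X)).

Definition LOCC_norm (A B : finType) (X : Op (A * B) (A * B)) : R :=
  sup [set v : R | exists (FA FB : finType) (p : proto nat FA FB A B),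
                     wf p /\ v = meas_norm p X].

Definition P_LOCC (A B : finType) (rho0 rho1 : Op (A * B) (A * B)) : R :=
  2^-1 + 4^-1 * LOCC_norm (fun i j => rho0 i j - rho1 i j).

(* joint state rho^{AB} (x) M^{A'B'}, arranged as (A A') | (B B') *)
Definition joint (A B MA MB : finType) (X : Op (A * B) (A * B))
  (M : Op (MA * MB) (MA * MB)) : Op ((A * MA) * (B * MB)) ((A * MA) * (B * MB)) :=
  fun i j => X (i.1.1, i.2.1) (j.1.1, j.2.1) * M (i.1.2, i.2.2) (j.1.2, j.2.2).

Definition pick_state (A B : finType) (rho0 rho1 : Op (A * B) (A * B)) (z : bool) :=
  if z then rho1 else rho0.

(* strat h: the LOCC protocol used in the next round after the history h of
   classical outcomes (indices of leaves reached in earlier rounds); its input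
   is (A A')|(B B'), its output the memory A'|B', its leaves carry the guess.
   mem_weight n h c M P = sum over the remaining n rounds (Z_j uniform) and
   all outcomes of the probability weight of the event "P(final count)",
   starting from the (unnormalised) memory state M and current count c. *)
Fixpoint mem_weight (A B MA MB : finType) (rho0 rho1 : Op (A * B) (A * B))
  (strat : seq nat -> proto bool MA MB (A * MA) (B * MB))
  (n : nat) (h : seq nat) (c : nat) (M : Op (MA * MB) (MA * MB))
  (P : nat -> bool) {struct n} : C :=
  match n with
  | 0 => if P c then tr M else 0
  | n'.+1 =>
      \sum_(z : bool) 2^-1 *
        \sum_(k < size (leaves (strat h)))
          let lf := nth (false, fun _ => fun _ _ => 0) (leaves (strat h)) k in
          mem_weight rho0 rho1 strat n' (rcons h k) (c + (lf.1 == z))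
                     (lf.2 (joint (pick_state rho0 rho1 z) M)) P
  end.

Definition mem_prob (A B MA MB : finType) (rho0 rho1 : Op (A * B) (A * B))
  (mu1 : Op (MA * MB) (MA * MB))
  (strat : seq nat -> proto bool MA MB (A * MA) (B * MB)) (n : nat) (r : R) : R :=
  complex.Re (mem_weight rho0 rho1 strat n [::] 0 mu1 (fun s => r * n%:R <= s%:R)).

Definition achievable (prob : nat -> R) (r : R) : Prop :=
  forall eps : R, 0 < eps -> forall m : nat, (0 < m)%N ->
    exists n : nat, (m <= n)%N /\ 1 - eps <= prob n.

Definition R_mem (A B : finType) (rho0 rho1 : Op (A * B) (A * B)) : R :=
  sup [set r : R | 0 <= r <= 1 /\
    exists (MA MB : finType) (mu1 : Op (MA * MB) (MA * MB))
           (strat : seq nat -> proto bool MA MB (A * MA) (B * MB)),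
      [/\ density mu1, (forall h, wf (strat h)) &
          achievable (fun n => mem_prob rho0 rho1 mu1 strat n r) r]].

Definition channel L (A B : finType) (p : proto L A B A B)
  (X : Op (A * B) (A * B)) : Op (A * B) (A * B) :=
  fun i j => \sum_(lf <- leaves p) lf.2 X i j.

(* Each round: Lambda maps rho_Z (x) tau to sigma_Z (x) tau, then the LOCC
   measurement Mz on AB (leaves labelled by the guess) is applied to sigma_Z,
   the catalyst being returned in the state tau.  q z g = Pr(Y = g | Z = z). *)
Definition guess_prob (A B FA FB : finType) (Mz : proto bool FA FB A B)
  (sigma : Op (A * B) (A * B)) (g : bool) : R :=
  complex.Re (\sum_(lf <- leaves Mz | lf.1 == g) tr (lf.2 sigma)).

Fixpoint round_weight (q : bool -> bool -> R) (n c : nat) (P : nat -> bool) : R :=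
  match n with
  | 0 => if P c then 1 else 0
  | n'.+1 => \sum_(z : bool) 2^-1 *
               \sum_(g : bool) q z g * round_weight q n' (c + (g == z)) P
  end.

Definition R_cat (A B : finType) (rho0 rho1 : Op (A * B) (A * B)) : R :=
  sup [set r : R | 0 <= r <= 1 /\
    exists (CA CB : finType) (tau : Op (CA * CB) (CA * CB))
           (Lam : proto unit (A * CA) (B * CB) (A * CA) (B * CB))
           (sigma0 sigma1 : Op (A * B) (A * B))
           (FA FB : finType) (Mz : proto bool FA FB A B),
      [/\ density tau, wf Lam, density sigma0 /\ density sigma1,
          (forall z : bool, forall i j,
             channel Lam (joint (pick_state rho0 rho1 z) tau) i j
             = joint (pick_state sigma0 sigma1 z) tau i j) /\
          wf Mz &
          achievable (fun n => round_weight
                         (fun z g => guess_prob Mz (pick_state sigma0 sigma1 z) g)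
                         n 0 (fun s => r * n%:R <= s%:R)) r]].

End Quantum.

Arguments Op R (S T)%_type.

(* Main.v *)
(* The memory state mu satisfies mu <= d diag(mu) with d the memory dimension, and
   diag(mu) is separable.  Since rho_0 and rho_1 are separable too, a run started
   from diag(mu) keeps the memory separable after every history; a product memory
   can be prepared locally, so each round then succeeds with conditional
   probability at most P_LOCC.  A Chebyshev estimate makes the probability of
   exceeding a rate r > P_LOCC of order 1/n, and the factor d lost by the
   domination does not depend on n.  Hence R_m <= P_LOCC.  A catalytic protocol is
   simulated by a memory protocol holding the catalyst, so R_c <= R_m, and the
   trivial catalyst with an LOCC measurement of bias close to the LOCC norm gives
   P_LOCC <= R_c. *)
Require Import Defs.
From HB Require Import structures.
From mathcomp Require Import all_boot all_order all_algebra.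
From mathcomp Require Import complex.
From mathcomp Require Import classical_sets reals.
From mathcomp Require Import boolp ring lra.

Set Implicit Arguments.
Unset Strict Implicit.
Unset Printing Implicit Defensive.

Import Order.TTheory GRing.Theory Num.Theory.
Local Open Scope ring_scope.

(** The obstacle is adaptivity combined with entanglement: protocols depend on the whole history, so
    rounds are not independent, and with an entangled memory a single round may beat [P_LOCC] by
    spending entanglement. The domination is therefore used once, on the initial state; it transfers
    to probabilities because the weight of an event is linear and positive in the memory operator.
    Independence is replaced by a potential, the squared positive part of the excess over the mean,
    whose expectation grows by at most 1 per round whatever the history. Memory operators stay
    unnormalised, their trace carrying the probability of the history, so no conditional state is
    ever formed. Applied to the deficit instead, the same potential gives the lower bound for i.i.d.
    rounds. *)

(** Leaves contain functions, which have no decidable equality, so facts valid along a list are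
    carried by [List.Forall] instead of membership. *)
Lemma eq_big_Forall (V : nmodType) (I : Type) (s : seq I) (F G : I -> V) :
  List.Forall (fun x => F x = G x) s ->
  \sum_(x <- s) F x = \sum_(x <- s) G x.
Proof.
elim => [|x s' FG _ IH]; first by rewrite !big_nil.
by rewrite !big_cons FG IH.
Qed.

Lemma Forall_nth (I : Type) (x0 : I) (s : seq I) (P : I -> Prop) (k : nat) :
  List.Forall P s -> (k < size s)%N -> P (nth x0 s k).
Proof. by move=> Ps; elim: Ps k => [|x s' Px _ IH] [|k] //= /IH. Qed.

Lemma Forall_map_imp (I J : Type) (f : I -> J) (s : seq I) (P : I -> Prop)
    (Q : J -> Prop) :
  (forall x, P x -> Q (f x)) -> List.Forall P s -> List.Forall Q (map f s).
Proof. by move=> PQ; elim => //= x s' Px _ IH; constructor; auto. Qed.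

Lemma Forall_flatten (I : Type) (P : I -> Prop) (ss : seq (seq I)) :
  List.Forall (List.Forall P) ss -> List.Forall P (flatten ss).
Proof. by elim => //= s ss' Ps _ IH; apply/List.Forall_app. Qed.

Lemma sum_delta (V : pzRingType) (T : finType) (a : T) (F : T -> V) :
  \sum_x (x == a)%:R * F x = F a.
Proof.
rewrite (bigD1 a) //= eqxx mul1r big1 ?addr0 // => x /negbTE ->.
by rewrite mul0r.
Qed.

Lemma sum_pair (V : nmodType) (S T : finType) (F : S * T -> V) :
  \sum_p F p = \sum_a \sum_b F (a, b).
Proof. by rewrite pair_bigA; apply: eq_bigr => -[]. Qed.

Lemma sum_unit (V : nmodType) (F : unit -> V) : \sum_i F i = F tt.
Proof. by rewrite (bigD1 tt) //= big1 ?addr0 // => -[]. Qed.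

(** Passes from leaves to outcomes: several leaves may share a label, and [meas_norm] takes absolute
    values only after adding them up. *)
Lemma sum_label_partition (V : pzRingType) (L : eqType) (T : Type)
    (s : seq (L * T)) (G : L -> V) (F : L * T -> V) :
  \sum_(x <- s) G x.1 * F x
    = \sum_(i <- undup (map fst s)) G i * \sum_(x <- s | x.1 == i) F x.
Proof.
(* The list of distinct labels changes with [s]; fixing any duplicate-free list that contains them
   lets the induction on [s] go through. *)
have main r : uniq r -> {subset map fst s <= r} ->
    \sum_(x <- s) G x.1 * F x = \sum_(i <- r) G i * \sum_(x <- s | x.1 == i) F x.
  move=> Ur; elim: s => [|x s IH] /= sr.
    by rewrite big_nil big1 // => i _; rewrite big_nil mulr0.
  rewrite big_cons IH; last by move=> y ys; apply: sr; rewrite inE ys orbT.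
  under [RHS]eq_bigr => i _.
    rewrite big_cons (_ : (if _ then _ else _) =
      (x.1 == i)%:R * F x + \sum_(j <- s | j.1 == i) F j); last first.
      by case: ifP => _; rewrite ?mul1r ?mul0r ?add0r.
    rewrite mulrDr; over.
  rewrite big_split /=; congr (_ + _).
  rewrite (bigD1_seq x.1) ?sr ?inE ?eqxx //= mul1r big1 ?addr0 // => i.
  by rewrite eq_sym => /negbTE ->; rewrite mul0r mulr0.
by apply: main; [exact: undup_uniq | move=> y; rewrite mem_undup].
Qed.

(** * Operators, Kraus maps and the cone of separable operators *)

Section Operators.
Variable R : realType.
Local Notation C := (R[i]).
Local Notation Op := (@Op R).

Lemma OpP (S T : finType) (X Y : Op S T) : (forall i j, X i j = Y i j) -> X = Y.
Proof. by move=> XY; apply/funext => i; apply/funext. Qed.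

Lemma conjcM (x y : C) : conjc (x * y) = conjc x * conjc y.
Proof. exact: rmorphM. Qed.

(* Op carries no module structure, so linearity is compatibility with finite
   linear combinations. *)
Definition linear_op (S T : finType) (F : Op S S -> Op T T) : Prop :=
  forall (I : Type) (s : seq I) (c : I -> C) (X : I -> Op S S),
    F (fun i j => \sum_(x <- s) c x * X x i j)
    = (fun i j => \sum_(x <- s) c x * F (X x) i j).

Definition linear_fun (S : finType) (F : Op S S -> C) : Prop :=
  forall (I : Type) (s : seq I) (c : I -> C) (X : I -> Op S S),
    F (fun i j => \sum_(x <- s) c x * X x i j) = \sum_(x <- s) c x * F (X x).

Definition psd_op (S T : finType) (F : Op S S -> Op T T) : Prop :=
  forall X, psd X -> psd (F X).

Definition kraus (S T : finType) (Vs : seq (Op T S)) (X : Op S S) : Op T T :=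
  fun i j => \sum_(V <- Vs) \sum_x \sum_y V i x * X x y * conjc (V j y).

Lemma linear_kraus (S T : finType) (Vs : seq (Op T S)) : linear_op (kraus Vs).
Proof.
move=> I s c X; apply: OpP => i j; rewrite /kraus.
under [RHS]eq_bigr do rewrite mulr_sumr.
rewrite [RHS]exchange_big /=; apply: eq_bigr => V _.
under [RHS]eq_bigr do rewrite mulr_sumr.
rewrite [RHS]exchange_big /=; apply: eq_bigr => x _.
under [RHS]eq_bigr do rewrite mulr_sumr.
rewrite [RHS]exchange_big /=; apply: eq_bigr => y _.
rewrite mulr_sumr mulr_suml; apply: eq_bigr => u _; ring.
Qed.

Lemma psd_kraus (S T : finType) (Vs : seq (Op T S)) : psd_op (kraus Vs).
Proof.
move=> X psdX v.
(* [u V] is the adjoint of [V] applied to [v]: the Kraus operators move from [X] onto the test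
   vector. *)
pose u (V : Op T S) x := \sum_i conjc (V i x) * v i.
suff -> : \sum_i \sum_j conjc (v i) * kraus Vs X i j * v j
    = \sum_(V <- Vs) \sum_x \sum_y conjc (u V x) * X x y * u V y.
  by apply: sumr_ge0 => V _; exact: psdX.
rewrite /kraus.
under eq_bigr => i _.
  under eq_bigr => j _ do rewrite mulr_sumr mulr_suml.
  rewrite exchange_big; over.
rewrite exchange_big /=; apply: eq_bigr => V _.
transitivity (\sum_j \sum_x \sum_i \sum_y
    conjc (v i) * (V i x * X x y * conjc (V j y)) * v j).
  rewrite exchange_big /=; apply: eq_bigr => j _.
  rewrite exchange_big /=; apply: eq_bigr => i _.
  by rewrite mulr_sumr mulr_suml; apply: eq_bigr => x _; rewrite mulr_sumr mulr_suml.
rewrite exchange_big /=; apply: eq_bigr => x _.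
under eq_bigr => j _ do rewrite exchange_big /=.
rewrite exchange_big /=; apply: eq_bigr => y _.
rewrite /u rmorph_sum /= mulr_sumr; apply: eq_bigr => j _.
rewrite 2!mulr_suml; apply: eq_bigr => i _.
rewrite conjcM conjcK; ring.
Qed.

Lemma linear_comp (S T U : finType) (F : Op T T -> Op U U) (G : Op S S -> Op T T) :
  linear_op F -> linear_op G -> linear_op (F \o G).
Proof. by move=> lF lG I s c X; rewrite /= lG lF. Qed.

Lemma linear_tr (S : finType) : linear_fun (@tr R S).
Proof.
move=> I s c X; rewrite /tr exchange_big; apply: eq_bigr => x _.
by rewrite mulr_sumr.
Qed.

Lemma psd_diag_ge0 (S : finType) (X : Op S S) i : psd X -> 0 <= X i i.
Proof.
move=> /(_ (fun j => (j == i)%:R)).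
under eq_bigr => j _.
  under eq_bigr => k _ do rewrite mulrC.
  rewrite sum_delta conjc_nat; over.
by rewrite sum_delta.
Qed.

Lemma psd_tr_ge0 (S : finType) (X : Op S S) : psd X -> 0 <= tr X.
Proof. by move=> pX; apply: sumr_ge0 => i _; exact: psd_diag_ge0. Qed.

Definition extA (A A' B : finType) (K : Op A' A) : Op (A' * B) (A * B) :=
  fun i j => (j.2 == i.2)%:R * K i.1 j.1.
Definition extB (A B B' : finType) (K : Op B' B) : Op (A * B') (A * B) :=
  fun i j => (j.1 == i.1)%:R * K i.2 j.2.

Lemma actA_kraus (A B A' : finType) (Ks : seq (Op A' A)) :
  actA Ks = kraus (map (@extA A A' B) Ks).
Proof.
apply/funext => X; apply: OpP => -[i1 i2] [j1 j2]; rewrite /actA /kraus big_map.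
apply: eq_bigr => K _.
rewrite sum_pair; apply: eq_bigr => x _.
rewrite /extA /=; under [RHS]eq_bigr => b _.
  under eq_bigr do rewrite -2!mulrA.
  rewrite -mulr_sumr; over.
rewrite [RHS]sum_delta.
rewrite sum_pair; apply: eq_bigr => y _ /=.
transitivity (\sum_b (b == j2)%:R * (K i1 x * (X (x, i2) (y, b) * conjc (K j1 y)))).
  by rewrite sum_delta mulrA.
apply: eq_bigr => b _; rewrite conjcM conjc_nat; ring.
Qed.

Lemma actB_kraus (A B B' : finType) (Ks : seq (Op B' B)) :
  actB Ks = kraus (map (@extB A B B') Ks).
Proof.
apply/funext => X; apply: OpP => -[i1 i2] [j1 j2]; rewrite /actB /kraus big_map.
apply: eq_bigr => K _.
rewrite sum_pair [RHS]exchange_big; apply: eq_bigr => x _.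
rewrite /extB /=; under [RHS]eq_bigr => b _.
  under eq_bigr do rewrite -2!mulrA.
  rewrite -mulr_sumr; over.
rewrite [RHS]sum_delta.
rewrite sum_pair [RHS]exchange_big; apply: eq_bigr => y _ /=.
transitivity (\sum_a (a == j1)%:R * (K i2 x * (X (i1, x) (a, y) * conjc (K j2 y)))).
  by rewrite sum_delta mulrA.
apply: eq_bigr => b _; rewrite conjcM conjc_nat; ring.
Qed.

Lemma linear_actA (A B A' : finType) (Ks : seq (Op A' A)) : linear_op (@actA R A B A' Ks).
Proof. by rewrite actA_kraus; exact: linear_kraus. Qed.
Lemma linear_actB (A B B' : finType) (Ks : seq (Op B' B)) : linear_op (@actB R A B B' Ks).
Proof. by rewrite actB_kraus; exact: linear_kraus. Qed.
Lemma psd_actA (A B A' : finType) (Ks : seq (Op A' A)) : psd_op (@actA R A B A' Ks).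
Proof. by rewrite actA_kraus; exact: psd_kraus. Qed.
Lemma psd_actB (A B B' : finType) (Ks : seq (Op B' B)) : psd_op (@actB R A B B' Ks).
Proof. by rewrite actB_kraus; exact: psd_kraus. Qed.

(** By cyclicity each branch contributes [X] paired with the sum of its adjoint-times-itself Kraus
    products; only the sum over all branches collapses, by [tp_loc]. *)
Lemma tr_actA (A B A' : finType) (Kss : seq (seq (Op A' A))) (X : Op (A * B) (A * B)) :
  tp_loc Kss -> \sum_(Ks <- Kss) tr (actA Ks X) = tr X.
Proof.
move=> tp; rewrite /tr.
transitivity (\sum_x \sum_y \sum_b X (x, b) (y, b) * (y == x)%:R); last first.
  rewrite sum_pair; apply: eq_bigr => x _ /=.
  rewrite exchange_big; apply: eq_bigr => b _.
  by under eq_bigr do rewrite mulrC; rewrite sum_delta.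
transitivity (\sum_(Ks <- Kss) \sum_(K <- Ks) \sum_x \sum_y \sum_b \sum_a
   X (x, b) (y, b) * (conjc (K a y) * K a x)).
  apply: eq_bigr => Ks _; rewrite /actA exchange_big /=; apply: eq_bigr => K _.
  rewrite exchange_big /=; apply: eq_bigr => x _.
  rewrite exchange_big /=; apply: eq_bigr => y _.
  rewrite sum_pair.
  rewrite exchange_big /=; apply: eq_bigr => b _; apply: eq_bigr => a _; ring.
under eq_bigr do rewrite exchange_big /=.
rewrite exchange_big /=; apply: eq_bigr => x _.
under eq_bigr do rewrite exchange_big /=.
rewrite exchange_big /=; apply: eq_bigr => y _.
under eq_bigr do rewrite exchange_big /=.
rewrite exchange_big /=; apply: eq_bigr => b _.
rewrite -(tp y x) mulr_sumr; apply: eq_bigr => Ks _.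
by rewrite mulr_sumr; apply: eq_bigr => K _; rewrite mulr_sumr.
Qed.

Lemma tr_actB (A B B' : finType) (Kss : seq (seq (Op B' B))) (X : Op (A * B) (A * B)) :
  tp_loc Kss -> \sum_(Ks <- Kss) tr (actB Ks X) = tr X.
Proof.
move=> tp; rewrite /tr.
transitivity (\sum_x \sum_y \sum_a X (a, x) (a, y) * (y == x)%:R); last first.
  rewrite sum_pair [RHS]exchange_big /=.
  apply: eq_bigr => x _ /=; rewrite exchange_big; apply: eq_bigr => b _.
  by under eq_bigr do rewrite mulrC; rewrite sum_delta.
transitivity (\sum_(Ks <- Kss) \sum_(K <- Ks) \sum_x \sum_y \sum_a \sum_b
   X (a, x) (a, y) * (conjc (K b y) * K b x)).
  apply: eq_bigr => Ks _; rewrite /actB exchange_big /=; apply: eq_bigr => K _.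
  rewrite exchange_big /=; apply: eq_bigr => x _.
  rewrite exchange_big /=; apply: eq_bigr => y _.
  rewrite sum_pair.
  by apply: eq_bigr => b _; apply: eq_bigr => a _ /=; ring.
under eq_bigr do rewrite exchange_big /=.
rewrite exchange_big /=; apply: eq_bigr => x _.
under eq_bigr do rewrite exchange_big /=.
rewrite exchange_big /=; apply: eq_bigr => y _.
under eq_bigr do rewrite exchange_big /=.
rewrite exchange_big /=; apply: eq_bigr => b _.
rewrite -(tp y x) mulr_sumr; apply: eq_bigr => Ks _.
by rewrite mulr_sumr; apply: eq_bigr => K _; rewrite mulr_sumr.
Qed.

(* |v><v| (x) |w><w|, unnormalised *)
Definition dyad (S T : finType) (v : S -> C) (w : T -> C) : Op (S * T) (S * T) :=
  fun i j => v i.1 * conjc (v j.1) * (w i.2 * conjc (w j.2)).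

(** Weights are absorbed into the vectors, so the cone is stable under branches that lose trace. The
    factor [1 *] gives the sum the shape required by [linear_op], so linearity rewrites it
    directly. *)
Definition sepcone (S T : finType) (X : Op (S * T) (S * T)) : Prop :=
  exists s : seq ((S -> C) * (T -> C)),
    X = fun i j => \sum_(u <- s) 1 * dyad u.1 u.2 i j.

(** A Kraus operator [K] of Alice turns the dyad of [v] and [w] into the dyad of [K v] and [w]. *)
Lemma sepcone_actA (A B A' : finType) (Ks : seq (Op A' A)) (X : Op (A * B) (A * B)) :
  sepcone X -> sepcone (actA Ks X).
Proof.
move=> [s ->]; rewrite linear_actA.
exists [seq ((fun a => \sum_x K a x * u.1 x), u.2) | u <- s, K <- Ks].
apply: OpP => i j; rewrite big_allpairs_dep /=; apply: eq_bigr => u _.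
rewrite /actA mul1r; apply: eq_bigr => K _; rewrite mul1r /dyad /=.
rewrite rmorph_sum /= mulr_suml mulr_suml; apply: eq_bigr => x _.
rewrite -mulrA mulr_suml mulr_sumr; apply: eq_bigr => y _.
rewrite conjcM; ring.
Qed.

Lemma sepcone_actB (A B B' : finType) (Ks : seq (Op B' B)) (X : Op (A * B) (A * B)) :
  sepcone X -> sepcone (actB Ks X).
Proof.
move=> [s ->]; rewrite linear_actB.
exists [seq (u.1, (fun b => \sum_x K b x * u.2 x)) | u <- s, K <- Ks].
apply: OpP => i j; rewrite big_allpairs_dep /=; apply: eq_bigr => u _.
rewrite /actB mul1r; apply: eq_bigr => K _; rewrite mul1r /dyad /=.
rewrite rmorph_sum /= mulr_suml mulr_sumr; apply: eq_bigr => x _.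
rewrite mulr_sumr mulr_sumr; apply: eq_bigr => y _.
rewrite conjcM; ring.
Qed.

Lemma separable_sepcone (S T : finType) (X : Op (S * T) (S * T)) :
  separable X -> sepcone X.
Proof.
move=> [n [p [psi [phi [p0 _ _ _ XE]]]]].
(* A dyad is quadratic in each vector, so the probability enters as a square root on Alice's
   side. *)
exists [seq ((fun a => real_complex R (Num.sqrt (p x)) * psi x a), phi x)
       | x <- enum 'I_n].
apply: OpP => i j; rewrite XE big_map big_enum; apply: eq_bigr => x _.
rewrite /dyad /= conjcM conjc_real.
rewrite -{1}(sqr_sqrtr (p0 x)) rmorphXn; ring.
Qed.

End Operators.

(** * Protocols *)

Section Protocols.
Variable R : realType.
Local Notation C := (R[i]).
Local Notation Op := (@Op R).
Local Notation proto := (@proto R).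

Section Induction.
Variables (L : Type) (FA FB : finType).

(** The continuations sit in a list of pairs, so their induction hypotheses are delivered through
    [List.Forall] by an inner induction on the branches. *)
Lemma proto_nested_ind (P : forall A B, proto L FA FB A B -> Prop) :
  (forall l, P FA FB (@Stop R L FA FB l)) ->
  (forall A B A' (brs : seq (seq (Op A' A) * proto L FA FB A' B)),
     List.Forall (fun br => P A' B br.2) brs -> P A B (AStep brs)) ->
  (forall A B B' (brs : seq (seq (Op B' B) * proto L FA FB A B')),
     List.Forall (fun br => P A B' br.2) brs -> P A B (BStep brs)) ->
  forall A B (p : proto L FA FB A B), P A B p.
Proof.
move=> PS PA PB; fix IH 3 => A B [l|A1 B1 A' brs|A1 B1 B' brs].
- exact: PS.
- apply: PA; elim: brs => [|[Ks q] brs IHbrs]; first exact: List.Forall_nil.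
  by apply: List.Forall_cons IHbrs; exact: IH.
- apply: PB; elim: brs => [|[Ks q] brs IHbrs]; first exact: List.Forall_nil.
  by apply: List.Forall_cons IHbrs; exact: IH.
Qed.

Lemma wf_AStep A B A' (brs : seq (seq (Op A' A) * proto L FA FB A' B)) :
  wf (AStep brs) <->
  tp_loc (map fst brs) /\ List.Forall (fun br => wf br.2) brs.
Proof.
split=> -[tp wfs]; split=> {tp}//.
  by elim: brs wfs => [|[Ks q] brs IH] //= [wfq /IH]; constructor.
by elim: wfs => //= -[Ks q] s wfq _ ?; split.
Qed.

Lemma wf_BStep A B B' (brs : seq (seq (Op B' B) * proto L FA FB A B')) :
  wf (BStep brs) <->
  tp_loc (map fst brs) /\ List.Forall (fun br => wf br.2) brs.
Proof.
split=> -[tp wfs]; split=> {tp}//.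
  by elim: brs wfs => [|[Ks q] brs IH] //= [wfq /IH]; constructor.
by elim: wfs => //= -[Ks q] s wfq _ ?; split.
Qed.

Lemma sum_leaves_AStep (V : nmodType) (G : L -> Op (FA * FB) (FA * FB) -> V)
    A B A' (brs : seq (seq (Op A' A) * proto L FA FB A' B)) X :
  \sum_(lf <- leaves (AStep brs)) G lf.1 (lf.2 X)
    = \sum_(br <- brs) \sum_(lf <- leaves br.2) G lf.1 (lf.2 (actA br.1 X)).
Proof.
rewrite /= big_flatten big_map; apply: eq_bigr => -[Ks q] _.
by rewrite big_map.
Qed.

Lemma sum_leaves_BStep (V : nmodType) (G : L -> Op (FA * FB) (FA * FB) -> V)
    A B B' (brs : seq (seq (Op B' B) * proto L FA FB A B')) X :
  \sum_(lf <- leaves (BStep brs)) G lf.1 (lf.2 X)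
    = \sum_(br <- brs) \sum_(lf <- leaves br.2) G lf.1 (lf.2 (actB br.1 X)).
Proof.
rewrite /= big_flatten big_map; apply: eq_bigr => -[Ks q] _.
by rewrite big_map.
Qed.

(** Local systems change along a protocol, hence a predicate indexed by [A] and [B]. Linearity,
    positivity and preservation of separability are the instances used. *)
Lemma leaves_Forall
    (Q : forall A B : finType, (Op (A * B) (A * B) -> Op (FA * FB) (FA * FB)) -> Prop) :
  Q FA FB id ->
  (forall (A B A' : finType) (Ks : seq (Op A' A)) F, Q A' B F -> Q A B (F \o actA Ks)) ->
  (forall (A B B' : finType) (Ks : seq (Op B' B)) F, Q A B' F -> Q A B (F \o actB Ks)) ->
  forall A B (p : proto L FA FB A B), List.Forall (fun lf => Q A B lf.2) (leaves p).
Proof.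
move=> Q1 QA QB; apply: proto_nested_ind => [l|A B A' brs IH|A B B' brs IH] /=.
- by constructor.
- apply: Forall_flatten; apply: Forall_map_imp IH => -[Ks q] /=.
  by apply: Forall_map_imp => lf; exact: QA.
- apply: Forall_flatten; apply: Forall_map_imp IH => -[Ks q] /=.
  by apply: Forall_map_imp => lf; exact: QB.
Qed.

Lemma leaves_linear A B (p : proto L FA FB A B) :
  List.Forall (fun lf => linear_op lf.2) (leaves p).
Proof.
apply: (@leaves_Forall (fun (A B : finType) F => linear_op F)) => // A1 B1 S Ks F lF.
  by apply: linear_comp => //; exact: linear_actA.
by apply: linear_comp => //; exact: linear_actB.
Qed.

Lemma leaves_psd A B (p : proto L FA FB A B) :
  List.Forall (fun lf => psd_op lf.2) (leaves p).
Proof.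
apply: (@leaves_Forall (fun (A B : finType) F => psd_op F)) => // A1 B1 S Ks F pF X pX.
  by apply: pF; exact: psd_actA.
by apply: pF; exact: psd_actB.
Qed.

Lemma leaves_sepcone A B (p : proto L FA FB A B) :
  List.Forall (fun lf => forall X, sepcone X -> sepcone (lf.2 X)) (leaves p).
Proof.
apply: (@leaves_Forall (fun (A B : finType) F => forall X, sepcone X -> sepcone (F X)))
  => // A1 B1 S Ks F sF X sX.
  by apply: sF; exact: sepcone_actA.
by apply: sF; exact: sepcone_actB.
Qed.

Lemma sum_leaves_tr A B (p : proto L FA FB A B) X :
  wf p -> \sum_(lf <- leaves p) tr (lf.2 X) = tr X.
Proof.
elim/proto_nested_ind: A B / p X => [l|A B A' brs IH|A B B' brs IH] X.
- by rewrite /= big_seq1.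
- move=> /wf_AStep[tp wfs].
  rewrite (sum_leaves_AStep (fun _ => @tr _ _)) -(tr_actA _ tp) big_map.
  apply: eq_big_Forall; elim: IH wfs => // br s' IHbr _ IHs wfs.
  by inversion wfs; constructor; [exact: IHbr | exact: IHs].
- move=> /wf_BStep[tp wfs].
  rewrite (sum_leaves_BStep (fun _ => @tr _ _)) -(tr_actB _ tp) big_map.
  apply: eq_big_Forall; elim: IH wfs => // br s' IHbr _ IHs wfs.
  by inversion wfs; constructor; [exact: IHbr | exact: IHs].
Qed.

End Induction.

(** Sequential composition: the label of the leaf reached selects the protocol that continues. *)
Fixpoint pbind (L L' : Type) (FA FB FA' FB' A B : finType)
    (p : proto L FA FB A B) {struct p} :
    (L -> proto L' FA' FB' FA FB) -> proto L' FA' FB' A B :=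
  match p in Defs.proto _ _ _ _ A B
    return (L -> proto L' FA' FB' FA FB) -> proto L' FA' FB' A B with
  | Stop l => fun k => k l
  | AStep A B A' brs => fun k =>
      AStep (map (fun br => let '(Ks, q) := br in (Ks, pbind q k)) brs)
  | BStep A B B' brs => fun k =>
      BStep (map (fun br => let '(Ks, q) := br in (Ks, pbind q k)) brs)
  end.

(* The ancilla is the second factor on each side, so extA extends Bob's Kraus
   operators as well as Alice's. *)
Fixpoint plift (L : Type) (FA FB MA MB A B : finType)
    (p : proto L FA FB A B) {struct p} :
    proto L (FA * MA)%type (FB * MB)%type (A * MA)%type (B * MB)%type :=
  match p in Defs.proto _ _ _ _ A B
    return proto L (FA * MA)%type (FB * MB)%type (A * MA)%type (B * MB)%type with
  | Stop l => @Stop R L (FA * MA)%type (FB * MB)%type l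
  | AStep A B A' brs =>
      AStep (map (fun br => let '(Ks, q) := br in
        (map (@extA R A A' MA) Ks, plift MA MB q)) brs)
  | BStep A B B' brs =>
      BStep (map (fun br => let '(Ks, q) := br in
        (map (@extA R B B' MB) Ks, plift MA MB q)) brs)
  end.

Lemma map_fst_pair (I J J' : Type) (f : J -> J') (s : seq (I * J)) :
  map fst (map (fun br => let '(a, b) := br in (a, f b)) s) = map fst s.
Proof. by rewrite -map_comp; apply: eq_map => -[]. Qed.

Lemma wf_pbind L L' (FA FB FA' FB' A B : finType) (p : proto L FA FB A B)
    (k : L -> proto L' FA' FB' FA FB) :
  wf p -> (forall l, wf (k l)) -> wf (pbind p k).
Proof.
move=> + wfk; elim/proto_nested_ind: A B / p => [l|A B A' brs IH|A B B' brs IH].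
- by move=> _; exact: wfk.
- move=> /wf_AStep[tp wfs]; apply/wf_AStep; rewrite map_fst_pair; split=> //.
  elim: IH wfs => {tp} [|[Ks q] s' IHbr _ IHs] wfs; first by constructor.
  by inversion wfs; constructor; [exact: IHbr | exact: IHs].
- move=> /wf_BStep[tp wfs]; apply/wf_BStep; rewrite map_fst_pair; split=> //.
  elim: IH wfs => {tp} [|[Ks q] s' IHbr _ IHs] wfs; first by constructor.
  by inversion wfs; constructor; [exact: IHbr | exact: IHs].
Qed.

Lemma sum_leaves_pbind L L' (FA FB FA' FB' A B : finType) (p : proto L FA FB A B)
    (k : L -> proto L' FA' FB' FA FB) (V : nmodType)
    (G : L' -> Op (FA' * FB') (FA' * FB') -> V) X :
  \sum_(lf <- leaves (pbind p k)) G lf.1 (lf.2 X)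
    = \sum_(lf <- leaves p) \sum_(lf' <- leaves (k lf.1)) G lf'.1 (lf'.2 (lf.2 X)).
Proof.
elim/proto_nested_ind: A B / p X => [l|A B A' brs IH|A B B' brs IH] X.
- by rewrite big_seq1.
- rewrite sum_leaves_AStep big_map.
  rewrite (sum_leaves_AStep (fun l Y => \sum_(lf' <- leaves (k l)) G lf'.1 (lf'.2 Y))).
  apply: eq_big_Forall; elim: IH => [|[Ks q] s' IHbr _ IHs]; constructor=> //=.
- rewrite sum_leaves_BStep big_map.
  rewrite (sum_leaves_BStep (fun l Y => \sum_(lf' <- leaves (k l)) G lf'.1 (lf'.2 Y))).
  apply: eq_big_Forall; elim: IH => [|[Ks q] s' IHbr _ IHs]; constructor=> //=.
Qed.

Lemma tp_loc_extA (A A' M : finType) (Kss : seq (seq (Op A' A))) :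
  tp_loc Kss -> tp_loc (map (map (@extA R A A' M)) Kss).
Proof.
move=> tp [x1 x2] [y1 y2]; rewrite big_map.
transitivity ((x2 == y2)%:R * (x1 == y1)%:R : C); last first.
  by rewrite xpair_eqE -natrM mulnb andbC.
rewrite -(tp x1 y1) mulr_sumr; apply: eq_bigr => Ks _.
rewrite big_map mulr_sumr; apply: eq_bigr => K _.
rewrite sum_pair mulr_sumr; apply: eq_bigr => a _; rewrite /extA /=.
transitivity (\sum_m (m == x2)%:R * ((m == y2)%:R * (conjc (K a x1) * K a y1))).
  apply: eq_bigr => m _; rewrite conjcM conjc_nat (eq_sym x2) (eq_sym y2); ring.
by rewrite sum_delta.
Qed.

Lemma actA_joint (A B A' MA MB : finType) (Ks : seq (Op A' A)) X
    (M : Op (MA * MB) (MA * MB)) :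
  actA (map (@extA R A A' MA) Ks) (@joint R A B MA MB X M) = joint (actA Ks X) M.
Proof.
apply: OpP => -[[i1 m1] [i2 m2]] [[j1 n1] [j2 n2]]; rewrite /actA /joint /= big_map.
rewrite mulr_suml; apply: eq_bigr => K _.
rewrite sum_pair mulr_suml; apply: eq_bigr => x _.
transitivity (\sum_m (m == m1)%:R * (\sum_y K i1 x * (X (x, i2) (y.1, j2)
    * M (m, m2) (y.2, n2)) * conjc (extA K (j1, n1) y))).
  apply: eq_bigr => m _; rewrite mulr_sumr; apply: eq_bigr => y _.
  by rewrite /extA /=; ring.
rewrite sum_delta sum_pair mulr_suml; apply: eq_bigr => y _ /=.
transitivity (\sum_m (m == n1)%:R * (K i1 x * X (x, i2) (y, j2) * conjc (K j1 y)
    * M (m1, m2) (m, n2))).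
  apply: eq_bigr => m _; rewrite /extA /= conjcM conjc_nat; ring.
by rewrite sum_delta.
Qed.

Lemma actB_joint (A B B' MA MB : finType) (Ks : seq (Op B' B)) X
    (M : Op (MA * MB) (MA * MB)) :
  actB (map (@extA R B B' MB) Ks) (@joint R A B MA MB X M) = joint (actB Ks X) M.
Proof.
apply: OpP => -[[i1 m1] [i2 m2]] [[j1 n1] [j2 n2]]; rewrite /actB /joint /= big_map.
rewrite mulr_suml; apply: eq_bigr => K _.
rewrite sum_pair mulr_suml; apply: eq_bigr => x _.
transitivity (\sum_m (m == m2)%:R * (\sum_y K i2 x * (X (i1, x) (j1, y.1)
    * M (m1, m) (n1, y.2)) * conjc (extA K (j2, n2) y))).
  apply: eq_bigr => m _; rewrite mulr_sumr; apply: eq_bigr => y _.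
  by rewrite /extA /=; ring.
rewrite sum_delta sum_pair mulr_suml; apply: eq_bigr => y _ /=.
transitivity (\sum_m (m == n2)%:R * (K i2 x * X (i1, x) (j1, y) * conjc (K j2 y)
    * M (m1, m2) (n1, m))).
  apply: eq_bigr => m _; rewrite /extA /= conjcM conjc_nat; ring.
by rewrite sum_delta.
Qed.

Lemma wf_plift L (FA FB MA MB A B : finType) (p : proto L FA FB A B) :
  wf p -> wf (plift MA MB p).
Proof.
elim/proto_nested_ind: A B / p => [l|A B A' brs IH|A B B' brs IH] //.
- move=> /wf_AStep[tp wfs]; apply/wf_AStep; split.
    rewrite -map_comp (eq_map (g := map (@extA R A A' MA) \o fst)) => [|[]//].
    by rewrite map_comp; exact: tp_loc_extA.
  elim: IH wfs => {tp} [|[Ks q] s' IHbr _ IHs] wfs; first by constructor.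
  by inversion wfs; constructor; [exact: IHbr | exact: IHs].
- move=> /wf_BStep[tp wfs]; apply/wf_BStep; split.
    rewrite -map_comp (eq_map (g := map (@extA R B B' MB) \o fst)) => [|[]//].
    by rewrite map_comp; exact: tp_loc_extA.
  elim: IH wfs => {tp} [|[Ks q] s' IHbr _ IHs] wfs; first by constructor.
  by inversion wfs; constructor; [exact: IHbr | exact: IHs].
Qed.

Lemma sum_leaves_plift L (FA FB MA MB A B : finType) (p : proto L FA FB A B)
    (V : nmodType) (G : L -> Op ((FA * MA) * (FB * MB)) ((FA * MA) * (FB * MB)) -> V)
    X (M : Op (MA * MB) (MA * MB)) :
  \sum_(lf <- leaves (plift MA MB p)) G lf.1 (lf.2 (joint X M))
    = \sum_(lf <- leaves p) G lf.1 (joint (lf.2 X) M).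
Proof.
elim/proto_nested_ind: A B / p X => [l|A B A' brs IH|A B B' brs IH] X.
- by rewrite !big_seq1.
- rewrite (sum_leaves_AStep G) big_map.
  rewrite (sum_leaves_AStep (fun l Y => G l (joint Y M))).
  apply: eq_big_Forall; elim: IH => [|[Ks q] s' IHbr _ IHs]; constructor=> //.
  by rewrite /= actA_joint; exact: IHbr.
- rewrite (sum_leaves_BStep G) big_map.
  rewrite (sum_leaves_BStep (fun l Y => G l (joint Y M))).
  apply: eq_big_Forall; elim: IH => [|[Ks q] s' IHbr _ IHs]; constructor=> //.
  by rewrite /= actB_joint; exact: IHbr.
Qed.

(** The Kraus operators of the partial trace over [F], one bra per basis index [a]. *)
Definition discardK (F M : finType) : seq (Op M (F * M)%type) :=
  [seq (fun c i => (i == (a, c))%:R) | a <- enum F].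

(** A memory strategy must end exactly in the memory systems, while a measurement leaves residual
    systems [FA] and [FB]; these are traced out locally. *)
Definition discard (L : Type) (FA FB MA MB : finType) (l : L) :
    proto L MA MB (FA * MA)%type (FB * MB)%type :=
  AStep [:: (discardK FA MA, BStep [:: (discardK FB MB, @Stop R L MA MB l)])].

Lemma tp_loc_discardK (F M : finType) : tp_loc [:: discardK F M].
Proof.
move=> [x1 x2] [y1 y2]; rewrite big_seq1 big_map big_enum /=.
transitivity (\sum_a \sum_c ((a, c) == (x1, x2))%:R * ((y1, y2) == (a, c))%:R : C).
  apply: eq_bigr => a _; apply: eq_bigr => c _.
  by rewrite conjc_nat eq_sym.
rewrite pair_bigA /=.
under eq_bigr => p _ do rewrite -surjective_pairing.
by rewrite sum_delta eq_sym.
Qed.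

Lemma wf_discard L (FA FB MA MB : finType) (l : L) : wf (@discard L FA FB MA MB l).
Proof.
apply/wf_AStep; split; first exact: tp_loc_discardK.
constructor=> //; apply/wf_BStep; split; first exact: tp_loc_discardK.
by constructor.
Qed.

Lemma discard_joint (FA FB MA MB : finType) Y (M : Op (MA * MB) (MA * MB)) :
  actB (discardK FB MB) (actA (discardK FA MA) (@joint R FA FB MA MB Y M))
  = (fun i j => tr Y * M i j).
Proof.
have collapse (F S : finType) c d (H : F * S -> F * S -> C) :
    \sum_(K <- discardK F S) \sum_x \sum_y K c x * H x y * conjc (K d y)
    = \sum_a H (a, c) (a, d).
  rewrite big_map big_enum; apply: eq_bigr => a _.
  under eq_bigr do under eq_bigr do rewrite -mulrA.
  under eq_bigr do rewrite -mulr_sumr.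
  rewrite sum_delta; under eq_bigr do rewrite conjc_nat mulrC.
  by rewrite sum_delta.
apply: OpP => -[i1 i2] [j1 j2]; rewrite /actB collapse /actA.
under eq_bigr do rewrite collapse.
rewrite exchange_big /tr sum_pair mulr_suml; apply: eq_bigr => a _.
by rewrite mulr_suml.
Qed.

(** The isometry that appends the vector [v]; it is trace preserving when [v] is a unit vector. *)
Definition prepK (S M : finType) (v : M -> C) : Op (S * M)%type S :=
  fun i a => (a == i.1)%:R * v i.2.

Definition prepare (L : Type) (FA FB A B MA MB : finType) (v : MA -> C) (w : MB -> C)
    (p : proto L FA FB (A * MA)%type (B * MB)%type) : proto L FA FB A B :=
  AStep [:: ([:: prepK v], BStep [:: ([:: prepK w], p)])].

Lemma tp_loc_prepK (S M : finType) (v : M -> C) :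
  \sum_m conjc (v m) * v m = 1 -> tp_loc [:: [:: @prepK S M v]].
Proof.
move=> v1 x y; rewrite !big_seq1 sum_pair /prepK /=.
transitivity (\sum_(a : S) (a == x)%:R * (a == y)%:R : C); last exact: sum_delta.
apply: eq_bigr => a _.
transitivity ((a == x)%:R * (a == y)%:R * \sum_m conjc (v m) * v m); last first.
  by rewrite v1 mulr1.
rewrite mulr_sumr; apply: eq_bigr => m _.
rewrite conjcM conjc_nat (eq_sym x) (eq_sym y); ring.
Qed.

Lemma wf_prepare L (FA FB A B MA MB : finType) (v : MA -> C) (w : MB -> C)
    (p : proto L FA FB (A * MA)%type (B * MB)%type) :
  \sum_m conjc (v m) * v m = 1 -> \sum_m conjc (w m) * w m = 1 -> wf p ->
  wf (prepare v w p).
Proof.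
move=> v1 w1 wfp; apply/wf_AStep; split; first exact: tp_loc_prepK.
constructor=> //; apply/wf_BStep; split; first exact: tp_loc_prepK.
by constructor.
Qed.

Lemma prepare_joint (A B MA MB : finType) (v : MA -> C) (w : MB -> C)
    (X : Op (A * B) (A * B)) :
  actB [:: prepK w] (actA [:: prepK v] X) = joint X (dyad v w).
Proof.
have collapse (S M : finType) (u : M -> C) c d (H : S -> S -> C) :
    \sum_x \sum_y prepK u c x * H x y * conjc (prepK u d y)
    = u c.2 * H c.1 d.1 * conjc (u d.2).
  rewrite /prepK; under eq_bigr do under eq_bigr do rewrite -2!mulrA.
  under eq_bigr do rewrite -mulr_sumr.
  rewrite sum_delta.
  transitivity (\sum_y (y == d.1)%:R * (u c.2 * H c.1 y * conjc (u d.2))).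
    apply: eq_bigr => y _; rewrite conjcM conjc_nat; ring.
  by rewrite sum_delta.
apply: OpP => -[[i1 m1] [i2 m2]] [[j1 n1] [j2 n2]].
rewrite /actB big_seq1 collapse /actA big_seq1 collapse /joint /dyad /=; ring.
Qed.

Lemma linear_joint (A B MA MB : finType) (X : Op (A * B) (A * B)) :
  linear_op (@joint R A B MA MB X).
Proof.
move=> I s c M; apply: OpP => i j; rewrite /joint mulr_sumr.
by apply: eq_bigr => u _; rewrite mulrCA.
Qed.

Lemma tr_joint (A B MA MB : finType) (X : Op (A * B) (A * B))
    (M : Op (MA * MB) (MA * MB)) : tr (joint X M) = tr X * tr M.
Proof.
rewrite /tr /joint !sum_pair.
transitivity (\sum_a \sum_m \sum_b \sum_n X (a, b) (a, b) * M (m, n) (m, n)).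
  by apply: eq_bigr => a _; apply: eq_bigr => m _; rewrite sum_pair.
rewrite mulr_suml; apply: eq_bigr => a _; rewrite exchange_big /= mulr_suml.
apply: eq_bigr => b _; rewrite mulr_sumr; apply: eq_bigr => m _.
by rewrite mulr_sumr.
Qed.

(** Each product term of [X] yields a Kraus operator that appends its product vector, so tensoring
    with [X] is itself a Kraus map acting on [M]. *)
Lemma psd_joint (A B MA MB : finType) (X : Op (A * B) (A * B)) :
  sepcone X -> psd_op (@joint R A B MA MB X).
Proof.
move=> [s ->] M pM.
rewrite (_ : joint _ M = kraus [seq (fun i m =>
  (m == (i.1.2, i.2.2))%:R * (u.1 i.1.1 * u.2 i.2.1)) | u <- s] M); first exact: psd_kraus.
apply: OpP => i j; rewrite /joint /kraus big_map mulr_suml; apply: eq_bigr => u _.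
under [RHS]eq_bigr do under eq_bigr do rewrite -2!mulrA.
under [RHS]eq_bigr do rewrite -mulr_sumr.
rewrite [RHS]sum_delta.
transitivity (\sum_y (y == (j.1.2, j.2.2))%:R * (u.1 i.1.1 * u.2 i.2.1 *
  (M (i.1.2, i.2.2) y * conjc (u.1 j.1.1 * u.2 j.2.1)))).
  by rewrite sum_delta conjcM /dyad /=; ring.
apply: eq_bigr => y _; rewrite [in RHS]conjcM conjc_nat; ring.
Qed.

Lemma sepcone_joint (A B MA MB : finType) (X : Op (A * B) (A * B))
    (M : Op (MA * MB) (MA * MB)) : sepcone X -> sepcone M -> sepcone (joint X M).
Proof.
move=> [s ->] [t ->].
exists [seq ((fun a => u.1 a.1 * u'.1 a.2), (fun b => u.2 b.1 * u'.2 b.2))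
       | u <- s, u' <- t].
apply: OpP => i j; rewrite big_allpairs_dep /joint mulr_suml; apply: eq_bigr => u _.
rewrite mulr_sumr; apply: eq_bigr => u' _; rewrite /dyad /= !conjcM; ring.
Qed.

End Protocols.

(** * Discrimination of two states *)

Section Discrimination.
Variable R : realType.
Local Notation C := (R[i]).
Local Notation Op := (@Op R).
Local Notation proto := (@proto R).
Local Notation toC := (real_complex R).

Lemma linear_op_sub (S T : finType) (F : Op S S -> Op T T) X Y :
  linear_op F ->
  F (fun i j => X i j - Y i j) = (fun i j => F X i j - F Y i j).
Proof.
move=> lF; have := lF bool [:: true; false] (fun b => (-1) ^+ ~~ b)
  (fun b => if b then X else Y).
under eq_fun do under eq_fun do rewrite !big_cons big_nil addr0 mul1r mulN1r.
by move=> ->; apply: OpP => i j; rewrite !big_cons big_nil addr0 mul1r mulN1r.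
Qed.

Lemma linear_fun_scale (S : finType) (F : Op S S -> C) a X :
  linear_fun F -> F (fun i j => a * X i j) = a * F X.
Proof.
move=> lF; have := lF unit [:: tt] (fun=> a) (fun=> X).
by under eq_fun do under eq_fun do rewrite big_seq1; move=> ->; rewrite big_seq1.
Qed.

Lemma linear_fun_sub (S : finType) (F : Op S S -> C) X Y :
  linear_fun F -> F (fun i j => X i j - Y i j) = F X - F Y.
Proof.
move=> lF; have := lF bool [:: true; false] (fun b => (-1) ^+ ~~ b)
  (fun b => if b then X else Y).
under eq_fun do under eq_fun do rewrite !big_cons big_nil addr0 mul1r mulN1r.
by move=> ->; rewrite !big_cons big_nil addr0 mul1r mulN1r.
Qed.

Lemma linear_fun_comp (S T : finType) (F : Op T T -> C) (G : Op S S -> Op T T) :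
  linear_fun F -> linear_op G -> linear_fun (fun X => F (G X)).
Proof. by move=> lF lG I s c X; rewrite lG lF. Qed.

Section MeasNorm.
Variables (A B FA FB : finType) (p : proto nat FA FB A B).

Lemma meas_normE X : toC (meas_norm p X)
  = \sum_(i <- undup (map fst (leaves p))) `|\sum_(lf <- leaves p | lf.1 == i) tr (lf.2 X)|.
Proof.
rewrite /meas_norm rmorph_sum; apply: eq_bigr => i _.
by rewrite normc_def; case: (\sum_(_ <- _ | _) _).
Qed.

Lemma meas_norm_ge X (e : nat -> C) : (forall i, `|e i| <= 1) ->
  `|\sum_(lf <- leaves p) e lf.1 * tr (lf.2 X)| <= toC (meas_norm p X).
Proof.
move=> e1; rewrite (sum_label_partition _ e (fun lf => tr (lf.2 X))) meas_normE.
apply: le_trans (ler_norm_sum _ _ _) _; apply: ler_sum => i _.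
by rewrite normrM ler_piMl.
Qed.

Lemma meas_norm_ge0 X : 0 <= meas_norm p X.
Proof.
by rewrite -ler0c meas_normE; apply: sumr_ge0 => i _; exact: normr_ge0.
Qed.

Variables rho0 rho1 : Op (A * B) (A * B).
Hypotheses (psd0 : psd rho0) (psd1 : psd rho1).
Local Notation diff := (fun i j => rho0 i j - rho1 i j).

Lemma sum_tr_diff (P : nat -> bool) :
  \sum_(lf <- leaves p | P lf.1) tr (lf.2 diff)
  = \sum_(lf <- leaves p | P lf.1) tr (lf.2 rho0)
    - \sum_(lf <- leaves p | P lf.1) tr (lf.2 rho1).
Proof.
rewrite -sumrB big_mkcond [RHS]big_mkcond; apply: eq_big_Forall.
elim: (leaves_linear p) => // lf s' lin _ IHs; constructor=> //; case: ifP => // _.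
by rewrite (linear_op_sub _ _ lin) linear_fun_sub //; exact: linear_tr.
Qed.

Lemma sum_tr_ge0 (X : Op (A * B) (A * B)) (P : nat -> bool) :
  psd X -> 0 <= \sum_(lf <- leaves p | P lf.1) tr (lf.2 X).
Proof.
move=> psdX; elim: (leaves_psd p) => [|lf s' plf _ IHs]; first by rewrite big_nil.
rewrite big_cons; case: ifP => // _; apply: addr_ge0 => //.
by apply: psd_tr_ge0; exact: plf.
Qed.

(** The bias of an outcome is a difference of two nonnegative traces, hence real, so a sign turns it
    into its absolute value. *)
Lemma meas_norm_sign :
  let e i := (-1) ^+ (complex.Re (\sum_(lf <- leaves p | lf.1 == i) tr (lf.2 diff)) < 0)%R in
  \sum_(lf <- leaves p) e lf.1 * tr (lf.2 diff) = toC (meas_norm p diff).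
Proof.
move=> e; rewrite (sum_label_partition _ e (fun lf => tr (lf.2 diff))) meas_normE.
apply: eq_bigr => i _; rewrite /e; set t := \sum_(_ <- _ | _) _.
have tr : t \is Num.real.
  rewrite /t (sum_tr_diff (fun l => l == i)); apply: rpredB; apply: ger0_real;
  exact: (sum_tr_ge0 (fun l => l == i)).
rewrite -(RRe_real tr) /= -[X in `|X|]/(toC _).
case: ltP => [lt0|ge0].
  by rewrite ltr0_norm ?mulN1r // -[0]/(toC 0) ltcR.
by rewrite mul1r ger0_norm // ler0c.
Qed.

(** Keeps the supremum in [LOCC_norm] finite: outcome by outcome the absolute difference is at most
    the sum of the two probabilities. *)
Lemma meas_norm_le2 : wf p -> tr rho0 = 1 -> tr rho1 = 1 -> meas_norm p diff <= 2.
Proof.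
move=> wfp t0 t1; rewrite -lecR meas_normE.
have -> : toC 2 = \sum_(lf <- leaves p) 1 * tr (lf.2 rho0)
    + \sum_(lf <- leaves p) 1 * tr (lf.2 rho1).
  under eq_bigr do rewrite mul1r.
  under [X in _ + X]eq_bigr do rewrite mul1r.
  by rewrite !sum_leaves_tr // t0 t1 rmorphD.
rewrite (sum_label_partition _ (fun=> 1) (fun lf => tr (lf.2 rho0))).
rewrite (sum_label_partition _ (fun=> 1) (fun lf => tr (lf.2 rho1))).
rewrite -big_split /=; apply: ler_sum => i _; rewrite !mul1r.
rewrite (sum_tr_diff (fun l => l == i)); apply: le_trans (ler_normB _ _) _.
by rewrite !ger0_norm //; exact: (sum_tr_ge0 (fun l => l == i)).
Qed.

End MeasNorm.

Section Guess.
Variables (A B : finType) (rho0 rho1 : Op (A * B) (A * B)).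
Local Notation diff := (fun i j => rho0 i j - rho1 i j).

Definition success (FA FB : finType) (p : proto bool FA FB A B) : C :=
  \sum_(z : bool) 2^-1 *
    \sum_(lf <- leaves p) (lf.1 == z)%:R * tr (lf.2 (pick_state rho0 rho1 z)).

(** The indicator of a correct guess is half of one plus or minus the sign of the label, and the
    leaf probabilities add up to 1. *)
Lemma success_bias (FA FB : finType) (p : proto bool FA FB A B) :
  wf p -> tr rho0 = 1 -> tr rho1 = 1 ->
  success p = 2^-1 + 4^-1 * \sum_(lf <- leaves p) (-1) ^+ lf.1 * tr (lf.2 diff).
Proof.
move=> wfp t0 t1.
have -> : \sum_(lf <- leaves p) (-1) ^+ lf.1 * tr (lf.2 diff)
  = \sum_(lf <- leaves p) ((-1) ^+ lf.1 * tr (lf.2 rho0)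
                          - (-1) ^+ lf.1 * tr (lf.2 rho1)).
  apply: eq_big_Forall; elim: (leaves_linear p) => // lf s' lin _ IHs.
  constructor=> //.
  by rewrite (linear_op_sub _ _ lin) linear_fun_sub ?mulrBr //; exact: linear_tr.
have split0 : \sum_(lf <- leaves p) (lf.1 == false)%:R * tr (lf.2 rho0)
    = 2^-1 + 2^-1 * \sum_(lf <- leaves p) (-1) ^+ lf.1 * tr (lf.2 rho0).
  set S := \sum_(lf <- leaves p) (-1) ^+ lf.1 * tr (lf.2 rho0).
  transitivity (2^-1 * (\sum_(lf <- leaves p) tr (lf.2 rho0) + S)).
    rewrite -big_split mulr_sumr.
    by apply: eq_bigr => -[[] F] _ /=; field.
  by rewrite sum_leaves_tr // t0 mulrDr mulr1.
have split1 : \sum_(lf <- leaves p) (lf.1 == true)%:R * tr (lf.2 rho1)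
    = 2^-1 - 2^-1 * \sum_(lf <- leaves p) (-1) ^+ lf.1 * tr (lf.2 rho1).
  set S := \sum_(lf <- leaves p) (-1) ^+ lf.1 * tr (lf.2 rho1).
  transitivity (2^-1 * (\sum_(lf <- leaves p) tr (lf.2 rho1) - S)).
    rewrite -sumrB mulr_sumr.
    by apply: eq_bigr => -[[] F] _ /=; field.
  by rewrite sum_leaves_tr // t1 mulrBr mulr1.
by rewrite /success big_bool /= split0 split1 sumrB; field.
Qed.

Definition relabel L L' (f : L -> L') (FA FB : finType) (p : proto L FA FB A B) :
  proto L' FA FB A B := pbind p (fun l => @Stop R L' FA FB (f l)).

Lemma wf_relabel L L' (f : L -> L') (FA FB : finType) (p : proto L FA FB A B) :
  wf p -> wf (relabel f p).
Proof. by move=> wfp; apply: wf_pbind. Qed.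

Lemma sum_leaves_relabel L L' (f : L -> L') (FA FB : finType) (p : proto L FA FB A B)
    (V : nmodType) (G : L' -> Op (FA * FB) (FA * FB) -> V) X :
  \sum_(lf <- leaves (relabel f p)) G lf.1 (lf.2 X)
    = \sum_(lf <- leaves p) G (f lf.1) (lf.2 X).
Proof. by rewrite sum_leaves_pbind; apply: eq_bigr => lf _; rewrite big_seq1. Qed.

Hypotheses (dens0 : density rho0) (dens1 : density rho1).

Local Notation values := [set v : R | exists (FA FB : finType)
  (p : proto nat FA FB A B), wf p /\ v = meas_norm p diff]%classic.

Lemma has_sup_meas_norm : has_sup values.
Proof.
split; first by exists (meas_norm (@Stop R nat A B 0%N) diff), A, B, (@Stop R nat A B 0%N).
exists 2 => _ [FA [FB [p [wfp ->]]]]; apply: meas_norm_le2 => //.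
- by case: dens0.
- by case: dens1.
- by case: dens0.
- by case: dens1.
Qed.

Lemma meas_norm_le_LOCC (FA FB : finType) (p : proto nat FA FB A B) :
  wf p -> meas_norm p diff <= LOCC_norm diff.
Proof.
move=> wfp; apply: ub_le_sup; first by case: has_sup_meas_norm.
by exists FA, FB, p.
Qed.

Lemma P_LOCC_gt0 : 0 < P_LOCC rho0 rho1.
Proof.
have := meas_norm_ge0 (@Stop R nat A B 0%N) diff.
have := @meas_norm_le_LOCC _ _ (@Stop R nat A B 0%N) I.
rewrite /P_LOCC; lra.
Qed.

Lemma P_LOCC_le1 : P_LOCC rho0 rho1 <= 1.
Proof.
have : LOCC_norm diff <= 2.
  apply: ge_sup; first by case: has_sup_meas_norm.
  move=> _ [FA [FB [p [wfp ->]]]]; apply: meas_norm_le2 => //.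
  - by case: dens0.
  - by case: dens1.
  - by case: dens0.
  - by case: dens1.
rewrite /P_LOCC; lra.
Qed.

Lemma success_le (FA FB : finType) (p : proto bool FA FB A B) :
  wf p -> success p <= toC (P_LOCC rho0 rho1).
Proof.
move=> wfp; have wfp' := wf_relabel nat_of_bool wfp.
rewrite success_bias //; [|by case: dens0|by case: dens1].
(* [LOCC_norm] ranges over protocols with outcomes in [nat]; viewing booleans as 0 and 1 leaves the
   signs unchanged. *)
have -> : \sum_(lf <- leaves p) (-1) ^+ lf.1 * tr (lf.2 diff)
    = \sum_(lf <- leaves (relabel nat_of_bool p)) (-1) ^+ lf.1 * tr (lf.2 diff).
  by rewrite (sum_leaves_relabel _ _ (fun l Y => (-1) ^+ l * tr Y)).
rewrite /P_LOCC rmorphD rmorphM !fmorphV /= !rmorph_nat.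
rewrite lerD2l ler_pM2l ?invr_gt0 ?ltr0n //.
apply: (@le_trans _ _ (toC (meas_norm (relabel nat_of_bool p) diff))); last first.
  by rewrite lecR meas_norm_le_LOCC.
rewrite -(meas_norm_sign (relabel nat_of_bool p)); [|by case: dens0|by case: dens1].
rewrite [leRHS]meas_norm_sign; [|by case: dens0|by case: dens1].
have re : \sum_(lf <- leaves (relabel nat_of_bool p)) (-1) ^+ lf.1 * tr (lf.2 diff)
    \is Num.real.
  rewrite (sum_label_partition _ (fun l => (-1) ^+ l) (fun lf => tr (lf.2 diff))).
  apply: rpred_sum => i _; rewrite (sum_tr_diff _ _ _ (fun l => l == i)).
  apply: rpredM; first by rewrite rpredX // rpredN rpred1.
  by apply: rpredB; apply: ger0_real; apply: (sum_tr_ge0 _ (fun l => l == i));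
    [case: dens0|case: dens1].
apply: le_trans (real_ler_norm re) _.
by apply: (meas_norm_ge _ _ (e := fun l => (-1) ^+ l)) => i; rewrite normrX normrN1 expr1n.
Qed.

(** Stated for [v] strictly below [P_LOCC], since the supremum over protocols need not be
    attained. *)
Lemma success_gt (v : R) : v < P_LOCC rho0 rho1 ->
  exists (FA FB : finType) (p : proto bool FA FB A B), wf p /\ toC v < success p.
Proof.
rewrite /P_LOCC => vP; pose eps := P_LOCC rho0 rho1 - v.
(* The factor 4 compensates the weight [4^-1] of the norm in [P_LOCC]. *)
have eps0 : 0 < 4 * eps by rewrite /eps /P_LOCC; lra.
have [_ [FA [FB [p [wfp ->]]]] lt] := sup_adherent eps0 has_sup_meas_norm.
(* Maximum likelihood: guess [rho1] exactly on the outcomes whose bias is negative. *)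
pose f i := complex.Re (\sum_(lf <- leaves p | lf.1 == i) tr (lf.2 diff)) < 0.
exists FA, FB, (relabel f p); split; first exact: wf_relabel.
rewrite success_bias; [|exact: wf_relabel|by case: dens0|by case: dens1].
rewrite (sum_leaves_relabel _ _ (fun (l : bool) Y => (-1) ^+ l * tr Y)).
rewrite (@meas_norm_sign _ _ _ _ p) ; [|by case: dens0|by case: dens1].
rewrite (_ : 2^-1 + _ = toC (2^-1 + 4^-1 * meas_norm p diff)); last first.
  by rewrite rmorphD rmorphM !fmorphV /= !rmorph_nat.
rewrite ltcR; move: lt; rewrite /eps /P_LOCC /LOCC_norm; lra.
Qed.

End Guess.

Lemma normalize (M : finType) (v : M -> C) :
  (forall m, v m = 0) \/
  exists (r : R) (v' : M -> C), \sum_m conjc (v' m) * v' m = 1 /\ v = (fun m => toC r * v' m).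
Proof.
set n := \sum_m conjc (v m) * v m.
have n_ge0 m : 0 <= conjc (v m) * v m by rewrite mulrC mulcJ_ge0.
have [n0|n_neq0] := eqVneq n 0.
  left=> m; have /eqP : conjc (v m) * v m = 0.
    by have /psumr_eq0P := n0; apply.
  by rewrite mulf_eq0 conjc_eq0 orbb => /eqP.
right; have nE : toC (complex.Re n) = n by rewrite RRe_real // ger0_real // sumr_ge0.
have n_gt0 : 0 < complex.Re n by rewrite -ltcR nE lt_def n_neq0 sumr_ge0.
set r := Num.sqrt (complex.Re n).
have r0 : toC r != 0.
  by rewrite -[0]/(toC 0) (inj_eq (@complexI R)) sqrtr_eq0 -ltNge.
exists r, (fun m => (toC r)^-1 * v m); split; last first.
  by apply/funext => m; rewrite mulVKf.
transitivity ((toC r ^+ 2)^-1 * n).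
  rewrite mulr_sumr; apply: eq_bigr => m _; rewrite conjcM conjc_inv conjc_real.
  by rewrite expr2 invfM; ring.
have -> : toC r ^+ 2 = n by rewrite -rmorphXn sqr_sqrtr ?(ltW n_gt0) //; exact: nE.
exact: mulVf.
Qed.

Lemma tr_dyad (S T : finType) (v : S -> C) (w : T -> C) :
  tr (dyad v w) = (\sum_m conjc (v m) * v m) * (\sum_m conjc (w m) * w m).
Proof.
rewrite /tr sum_pair mulr_suml; apply: eq_bigr => m _; rewrite mulr_sumr.
by apply: eq_bigr => k _; rewrite /dyad /=; ring.
Qed.

(** Linearity rescales every product term to unit vectors; terms with a zero vector, which cannot be
    normalised, contribute 0 on both sides. *)
Lemma sepcone_le (S T : finType) (F : Op (S * T) (S * T) -> C) (c : C) :
  linear_fun F ->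
  (forall v w, \sum_m conjc (v m) * v m = 1 -> \sum_m conjc (w m) * w m = 1 ->
     F (dyad v w) <= c) ->
  forall M, sepcone M -> F M <= c * tr M.
Proof.
move=> lF Fc _ [s ->]; rewrite lF linear_tr mulr_sumr.
apply: ler_sum => -[v w] _ /=; rewrite !mul1r.
have zero : (forall i j, dyad v w i j = 0) -> F (dyad v w) <= c * tr (dyad v w).
  move=> d0; rewrite (_ : dyad v w = fun i j => 0 * dyad v w i j).
    by rewrite (linear_fun_scale _ _ lF) (linear_fun_scale _ _ (@linear_tr R _))
      !mul0r mulr0.
  by apply: OpP => i j; rewrite d0 mul0r.
have [v0|[r [v' [v1 vE]]]] := normalize v.
  by apply: zero => i j; rewrite /dyad v0 !mul0r.
have [w0|[t [w' [w1 wE]]]] := normalize w.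
  by apply: zero => i j; rewrite /dyad w0 mul0r mulr0.
rewrite vE wE (_ : dyad _ _ = fun i j => toC (r ^+ 2 * t ^+ 2) * dyad v' w' i j).
  rewrite (linear_fun_scale _ _ lF) (linear_fun_scale _ _ (@linear_tr R _)).
  rewrite tr_dyad v1 w1 !mulr1 mulrC ler_wpM2r ?Fc //.
  by rewrite ler0c mulr_ge0 // sqr_ge0.
apply: OpP => i j; rewrite /dyad !conjcM !conjc_real rmorphM !rmorphXn; ring.
Qed.

Section PsdDiag.
Variables (S T : finType) (mu : Op (S * T) (S * T)).
Hypothesis psd_mu : psd mu.

(** The dimension times the dephasing of [mu] in the product basis. *)
Definition diag_bound : Op (S * T) (S * T) :=
  fun i j => (i == j)%:R * (#|{: S * T}|%:R * mu i i).

Lemma tr_diag_bound : tr diag_bound = #|{: S * T}|%:R * tr mu.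
Proof.
by rewrite /tr mulr_sumr; apply: eq_bigr => i _; rewrite /diag_bound eqxx mul1r.
Qed.

(** An operator diagonal in a product basis with nonnegative entries is a weighted sum of product
    basis projectors. *)
Lemma sepcone_diag_bound : sepcone diag_bound.
Proof.
exists [seq ((fun a => toC (Num.sqrt (#|{: S * T}|%:R * complex.Re (mu p p)))
                        * (p.1 == a)%:R),
             (fun b => (p.2 == b)%:R)) | p <- enum {: S * T}].
apply: OpP => i j; rewrite big_map big_enum /=.
transitivity (\sum_p (p == i)%:R * diag_bound p j); first by rewrite sum_delta.
apply: eq_bigr => p _; rewrite /diag_bound /dyad /= mul1r conjcM conjc_real !conjc_nat.
have -> : #|{: S * T}|%:R * mu p p
    = toC (Num.sqrt (#|{: S * T}|%:R * complex.Re (mu p p))) ^+ 2.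
  have mu_ge0 := psd_diag_ge0 p psd_mu.
  have re_ge0 : 0 <= complex.Re (mu p p) by rewrite -ler0c RRe_real ?ger0_real.
  rewrite -rmorphXn sqr_sqrtr ?mulr_ge0 // rmorphM rmorph_nat; congr (_ * _).
  by symmetry; apply: RRe_real; exact: ger0_real.
case: p i j => [p1 p2] [i1 i2] [j1 j2] /=; rewrite !xpair_eqE -!mulnb !natrM; ring.
Qed.

(* d sum_k |v_k|^2 mu_kk - <v|mu|v> is half the sum over k, l of the values of
   the form mu at v_k e_k - v_l e_l. *)
Lemma psd_diag_bound : psd (fun i j => diag_bound i j - mu i j).
Proof.
move=> v.
pose w k l i := (i == k)%:R * v k - (i == l)%:R * v l.
have collapse k l (F : S * T -> C) : \sum_i F i * w k l i = F k * v k - F l * v l.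
  under eq_bigr do rewrite /w mulrBr !(mulrCA (F _)).
  by rewrite sumrB !sum_delta.
have form k l : \sum_i \sum_j conjc (w k l i) * mu i j * w k l j
    = conjc (v k) * mu k k * v k + conjc (v l) * mu l l * v l
      - conjc (v k) * mu k l * v l - conjc (v l) * mu l k * v k.
  under eq_bigr => i _ do rewrite (collapse k l (fun j => conjc (w k l i) * mu i j)).
  transitivity (\sum_i ((i == k)%:R * (conjc (v k) * (mu i k * v k - mu i l * v l))
      - (i == l)%:R * (conjc (v l) * (mu i k * v k - mu i l * v l)))).
    apply: eq_bigr => i _; rewrite /w rmorphB /= !conjcM !conjc_nat; ring.
  rewrite sumrB !sum_delta; ring.
suff -> : \sum_i \sum_j conjc (v i) * (diag_bound i j - mu i j) * v j
    = 2^-1 * \sum_k \sum_l \sum_i \sum_j conjc (w k l i) * mu i j * w k l j.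
  rewrite mulr_ge0 ?invr_ge0 ?ler0n //.
  by apply: sumr_ge0 => k _; apply: sumr_ge0 => l _; exact: psd_mu.
set D := \sum_k conjc (v k) * mu k k * v k.
set Q := \sum_k \sum_l conjc (v k) * mu k l * v l.
have -> : \sum_k \sum_l \sum_i \sum_j conjc (w k l i) * mu i j * w k l j
    = #|{: S * T}|%:R * D + #|{: S * T}|%:R * D - Q - Q.
  under eq_bigr do under eq_bigr do rewrite form.
  under eq_bigr do rewrite !sumrB big_split /=.
  rewrite !sumrB big_split /=; congr (_ + _ - _ - _).
  - by under eq_bigr do rewrite sumr_const -mulr_natl; rewrite -mulr_sumr.
  - by rewrite sumr_const mulr_natl.
  - by rewrite exchange_big.
transitivity (#|{: S * T}|%:R * D - Q); last by field.
rewrite /D /Q mulr_sumr -sumrB; apply: eq_bigr => i _.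
transitivity (\sum_j ((j == i)%:R * (#|{: S * T}|%:R * (conjc (v i) * mu i i * v j))
   - conjc (v i) * mu i j * v j)).
  apply: eq_bigr => j _; rewrite /diag_bound (eq_sym i); ring.
by rewrite sumrB sum_delta.
Qed.

End PsdDiag.

End Discrimination.

(** * Repeated rounds *)

Section Potential.
Variable R : realType.

Definition pos_sq (x : R) : R := Num.max x 0 ^+ 2.

(** For a Bernoulli step of mean [q], a squared shift exceeds its value at the mean by the variance
    [q (1 - q)], which is at most 1; the positive part preserves the bound. *)
Lemma pos_sq_step (q x : R) : 0 <= q <= 1 ->
  q * pos_sq (x + 1) + (1 - q) * pos_sq x <= pos_sq (x + q) + 1.
Proof.
move=> /andP[q0 q1]; rewrite /pos_sq.
by case: (lerP x 0) => ?; case: (lerP (x + 1) 0) => ?; case: (lerP (x + q) 0) => ?; nra.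
Qed.

Lemma pos_sq_le (x y : R) : x <= y -> pos_sq x <= pos_sq y.
Proof.
move=> xy; rewrite /pos_sq; case: (lerP x 0) => ?; case: (lerP y 0) => ?; nra.
Qed.

Lemma pos_sq_ge0 (x : R) : 0 <= pos_sq x.
Proof. exact: sqr_ge0. Qed.

(* n further rounds contribute at most n to the variance, so this bounds
   Pr(excess + (centred sum over n rounds) >= t) by Chebyshev *)
Definition tail (t : R) (n : nat) (x : R) : R := (pos_sq x + n%:R) / t ^+ 2.

(** Written as the value after failure plus [q] times an increment: the increment is nonnegative, so
    an upper bound on the success probability can replace the true one. *)
Lemma tail_step (t q x : R) n : 0 <= q <= 1 ->
  tail t n x + q * (tail t n (x + 1) - tail t n x) <= tail t n.+1 (x + q).
Proof.
move=> q01; rewrite /tail -mulrBl mulrA -mulrDl ler_wpM2r ?invr_ge0 ?sqr_ge0 //.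
have := pos_sq_step x q01; rewrite -natr1; lra.
Qed.

Lemma tail_le (t x y : R) n : x <= y -> tail t n x <= tail t n y.
Proof.
by move=> xy; rewrite /tail ler_wpM2r ?invr_ge0 ?sqr_ge0 // lerD2r pos_sq_le.
Qed.

Lemma tail_ge0 (t x : R) n : 0 <= tail t n x.
Proof. by rewrite /tail mulr_ge0 ?invr_ge0 ?sqr_ge0 // addr_ge0 ?pos_sq_ge0. Qed.

(** At the end of a run the potential dominates the indicator of the deviation event. *)
Lemma tail0_ge1 (t x : R) : 0 < t -> t <= x -> 1 <= tail t 0 x.
Proof.
move=> t0 tx; rewrite /tail addr0 ler_pdivlMr ?exprn_gt0 // mul1r /pos_sq.
by rewrite max_l ?lerXn2r ?nnegrE //; lra.
Qed.

Lemma tail_vanishes (d eps delta : R) : 0 <= d -> 0 < eps -> 0 < delta ->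
  (* The quantity equals [d / (n * delta ^+ 2)], which falls below [eps] once [n] exceeds
     [d / (eps * delta ^+ 2)]. *)
  exists m : nat, forall n, (m <= n)%N -> d * tail (n%:R * delta) n 0 < eps.
Proof.
move=> d0 e0 a0; pose b := d / (eps * delta ^+ 2).
have b0 : 0 <= b by rewrite /b divr_ge0 // mulr_ge0 ?sqr_ge0 ?ltW.
exists (Num.Def.archi_bound b).+1 => n le_n.
have bn : b < n%:R.
  apply: lt_le_trans (archi_boundP b0) _; rewrite ler_nat; exact: ltnW.
have n0 : (0 : R) < n%:R by apply: le_lt_trans bn.
have ed : 0 < eps * delta ^+ 2 by rewrite mulr_gt0 ?exprn_gt0.
rewrite /tail /pos_sq maxxx expr0n /= add0r.
rewrite (_ : d * _ = d / (eps * delta ^+ 2) / n%:R * eps); last first.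
  by field; rewrite !gt_eqF.
by rewrite -[ltRHS]mul1r ltr_pM2r // ltr_pdivrMr // mul1r.
Qed.

End Potential.

(** * Upper bound for memory-assisted protocols *)

Section Memory.
Variable R : realType.
Local Notation C := (R[i]).
Local Notation Op := (@Op R).
Local Notation proto := (@proto R).
Local Notation toC := (real_complex R).
Variables (A B MA MB : finType) (rho0 rho1 : Op (A * B) (A * B)).

Lemma sum_leaves_nth L (FA FB : finType) A' B' (p : proto L FA FB A' B') x0 (F : _ -> C) :
  \sum_(k < size (leaves p)) F (nth x0 (leaves p) k) = \sum_(lf <- leaves p) F lf.
Proof. by rewrite (big_nth x0) big_mkord. Qed.

Section Strategy.
Variable strat : seq nat -> proto bool MA MB (A * MA)%type (B * MB)%type.

Lemma linear_mem_weight n h c P :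
  linear_fun (fun M => mem_weight rho0 rho1 strat n h c M P).
Proof.
elim: n h c => [|n IH] h c I s a M /=.
  by case: ifP => _; rewrite ?linear_tr // big1 // => i _; rewrite mulr0.
under [RHS]eq_bigr do rewrite mulr_sumr; rewrite [RHS]exchange_big /=.
apply: eq_bigr => z _; rewrite mulr_sumr.
under [RHS]eq_bigr do rewrite mulrCA !mulr_sumr; rewrite [RHS]exchange_big /=.
apply: eq_bigr => k _; rewrite linear_joint.
rewrite (Forall_nth _ (leaves_linear (strat h)) (ltn_ord k)) IH mulr_sumr.
by apply: eq_bigr => i _; ring.
Qed.

Hypotheses (sep0 : sepcone rho0) (sep1 : sepcone rho1).

Lemma sepcone_pick z : sepcone (pick_state rho0 rho1 z).
Proof. by case: z. Qed.

(** Needed for every positive memory operator, entangled or not, because it is applied to the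
    difference between the dominating operator and [mu]. *)
Lemma mem_weight_ge0 n h c M P : psd M -> 0 <= mem_weight rho0 rho1 strat n h c M P.
Proof.
elim: n h c M => [|n IH] h c M psdM /=.
  by case: ifP => // _; exact: psd_tr_ge0.
apply: sumr_ge0 => z _; rewrite mulr_ge0 ?invr_ge0 ?ler0n //.
apply: sumr_ge0 => k _; apply: IH.
apply: (Forall_nth _ (leaves_psd (strat h)) (ltn_ord k)).
by apply: psd_joint => //; exact: sepcone_pick.
Qed.

Lemma psd_sepcone (S T : finType) (M : Op (S * T) (S * T)) : sepcone M -> psd M.
Proof.
move=> [s ->].
rewrite (_ : (fun i j => _) = kraus [seq (fun i (_ : unit) => u.1 i.1 * u.2 i.2) | u <- s]
  (fun _ _ => 1)).
  apply: psd_kraus => v; rewrite !sum_unit.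
  by rewrite mulr1 mulrC mulcJ_ge0.
apply: OpP => i j; rewrite /kraus big_map; apply: eq_bigr => u _.
by rewrite !sum_unit /dyad conjcM; ring.
Qed.

Hypotheses (dens0 : density rho0) (dens1 : density rho1).
Local Notation q := (P_LOCC rho0 rho1).

Lemma linear_success (FA FB : finType) (p : proto bool FA FB (A * MA)%type (B * MB)%type) :
  linear_fun (fun M => success (joint rho0 M) (joint rho1 M) p).
Proof.
move=> I s a M; rewrite /success.
under [RHS]eq_bigr do rewrite mulr_sumr; rewrite [RHS]exchange_big /=.
apply: eq_bigr => z _.
under [RHS]eq_bigr do rewrite mulrCA.
rewrite -mulr_sumr; congr (_ * _).
have -> M' : pick_state (joint rho0 M') (joint rho1 M') z = joint (pick_state rho0 rho1 z) M'.
  by case: z.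
rewrite linear_joint; under [RHS]eq_bigr do rewrite mulr_sumr.
rewrite exchange_big; apply: eq_big_Forall.
elim: (leaves_linear p) => // lf s' lin _ IHs; constructor=> //.
rewrite lin linear_tr mulr_sumr; apply: eq_bigr => i _ /=.
by case: z {IHs} => /=; ring.
Qed.

(** For a product memory, local preparation makes the round an LOCC discrimination of [rho0] and
    [rho1] alone. The trace on the right is the probability of the history, so this is a conditional
    bound without division. *)
Lemma success_joint (FA FB : finType) (p : proto bool FA FB (A * MA)%type (B * MB)%type) M :
  wf p -> sepcone M -> success (joint rho0 M) (joint rho1 M) p <= toC q * tr M.
Proof.
move=> wfp sepM; apply: (sepcone_le (linear_success p) _ sepM).
move=> v w v1 w1.
rewrite (_ : success _ _ _ = success rho0 rho1 (prepare v w p)).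
  by apply: success_le => //; exact: wf_prepare.
apply: eq_bigr => z _; congr (_ * _).
rewrite (sum_leaves_AStep (fun l Y => (l == z)%:R * tr Y)) big_seq1.
rewrite (sum_leaves_BStep (fun l Y => (l == z)%:R * tr Y)) big_seq1 /=.
by rewrite prepare_joint; case: z.
Qed.

Hypothesis wf_strat : forall h, wf (strat h).

(** The argument of [tail] is the current count plus the mean still to come at rate [q], minus the
    offset [b]. It rises by [1 - q] on success and drops by [q] on failure, while [t] and [b] stay
    fixed along the induction. *)
Lemma mem_weight_le t b n h c M : sepcone M -> 0 < t ->
  mem_weight rho0 rho1 strat n h c M (fun s => t + b <= s%:R)
    <= toC (tail t n (c%:R + n%:R * q - b)) * tr M.
Proof.
move=> + t0; elim: n h c M => [|n IH] h c M sepM.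
  rewrite /= mul0r addr0; have tr0 := psd_tr_ge0 (psd_sepcone sepM).
  case: ifP => [le|_]; last by rewrite mulr_ge0 ?ler0c ?tail_ge0.
  by rewrite -[leLHS]mul1r ler_wpM2r // -[1]/(toC 1) lecR tail0_ge1 // lerBrDr.
set x := c%:R + n%:R * q - b.
have -> : c%:R + n.+1%:R * q - b = x + q by rewrite /x -natr1; ring.
(* [u] is the potential after a wrong guess and [w] the gain from a right one; since [w] is
   nonnegative, [success_joint] applies. *)
pose u := toC (tail t n x); pose w := toC (tail t n (x + 1) - tail t n x).
have main : mem_weight rho0 rho1 strat n.+1 h c M (fun s => t + b <= s%:R)
    <= u * tr M + w * success (joint rho0 M) (joint rho1 M) (strat h).
  have -> : u * tr M = \sum_(z : bool) 2^-1 * (u * \sum_(lf <- leaves (strat h))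
      tr (lf.2 (joint (pick_state rho0 rho1 z) M))).
    under eq_bigr do rewrite sum_leaves_tr // tr_joint.
    by rewrite big_bool /=; case: dens0 => _ ->; case: dens1 => _ ->; field.
  rewrite /success mulr_sumr -big_split /=; apply: ler_sum => z _.
  rewrite [w * _]mulrCA -mulrDr ler_wpM2l ?invr_ge0 ?ler0n //.
  pose F (lf : bool * (Op ((A * MA) * (B * MB)) ((A * MA) * (B * MB))
      -> Op (MA * MB) (MA * MB))) :=
    (u + w * (lf.1 == z)%:R) * tr (lf.2 (joint (pick_state rho0 rho1 z) M)).
  apply: (@le_trans _ _ (\sum_(lf <- leaves (strat h)) F lf)).
    rewrite -(sum_leaves_nth (strat h) (false, fun _ => fun _ _ => 0)).
    apply: ler_sum => k _.
    set lf := nth _ _ _.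
    have sep : sepcone (lf.2 (joint (pick_state rho0 rho1 z) M)).
      apply: (Forall_nth _ (leaves_sepcone (strat h)) (ltn_ord k)).
      by apply: sepcone_joint => //; exact: sepcone_pick.
    apply: le_trans (IH _ _ _ sep) _; rewrite /F ler_wpM2r ?(psd_tr_ge0 (psd_sepcone sep)) //.
    case: (lf.1 == z); last by rewrite addn0 mulr0 addr0.
    rewrite mulr1 -rmorphD /= [tail t n x + _]addrC subrK natrD.
    by rewrite (_ : _ + _ * q - b = x + 1) // /x; ring.
  rewrite !mulr_sumr -big_split /= le_eqVlt; apply/orP; left; apply/eqP.
  by apply: eq_bigr => lf _; rewrite /F; case: z {F} => /=; ring.
apply: (le_trans main).
have w0 : 0 <= w by rewrite ler0c subr_ge0 tail_le // lerDl.
apply: (@le_trans _ _ (u * tr M + w * (toC q * tr M))).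
  by rewrite lerD2l ler_wpM2l // success_joint.
rewrite mulrA -mulrDl ler_wpM2r ?(psd_tr_ge0 (psd_sepcone sepM)) //.
rewrite -rmorphM -rmorphD lecR [_ * q]mulrC; apply: tail_step.
by rewrite P_LOCC_le1 // ltW ?P_LOCC_gt0.
Qed.

Lemma mem_prob_le mu n r : density mu -> q < r -> (0 < n)%N ->
  mem_prob rho0 rho1 mu strat n r
    <= #|{: MA * MB}|%:R * tail (n%:R * (r - q)) n 0.
Proof.
move=> [psd_mu tr_mu] qr n0; rewrite -lecR.
have real_w : mem_weight rho0 rho1 strat n [::] 0 mu (fun s => r * n%:R <= s%:R) \is Num.real.
  by rewrite ger0_real // mem_weight_ge0.
rewrite /mem_prob RRe_real //.
(* Positivity on the difference, split by linearity, bounds the weight from [mu] by the weight from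
   the separable [diag_bound]. *)
have := mem_weight_ge0 n [::] 0 (fun s => r * n%:R <= s%:R) (psd_diag_bound psd_mu).
rewrite (linear_fun_sub _ _ (linear_mem_weight n [::] 0 _)) subr_ge0 => /le_trans; apply.
have t0 : 0 < n%:R * (r - q) by rewrite mulr_gt0 ?ltr0n // subr_gt0.
have := mem_weight_le (n%:R * q) n [::] 0 (sepcone_diag_bound psd_mu) t0.
rewrite (_ : n%:R * (r - q) + n%:R * q = r * n%:R); last by ring.
rewrite add0r subrr tr_diag_bound tr_mu mulr1 [toC _ * _]mulrC => le.
by rewrite rmorphM rmorph_nat.
Qed.

Lemma mem_achievable_le mu r : density mu ->
  achievable (fun n => mem_prob rho0 rho1 mu strat n r) r -> r <= q.
Proof.
move=> dmu ach; rewrite leNgt; apply/negP => qr.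
have h0 : (0 : R) < 2^-1 by rewrite invr_gt0 ltr0n.
have rq0 : 0 < r - q by rewrite subr_gt0.
(* With tolerance 1/2, achievability demands probability at least 1/2 at arbitrarily large [n],
   while the bound drops below 1/2. *)
have [m vanish] := tail_vanishes (ler0n R #|{: MA * MB}|) h0 rq0.
have [n [mn]] := ach _ h0 m.+1 isT.
have n0 : (0 < n)%N by apply: leq_trans mn.
have := mem_prob_le dmu qr n0; have := vanish n (ltnW mn); lra.
Qed.

End Strategy.

End Memory.

(** * Law of large numbers for independent rounds *)

Section Rounds.
Variable R : realType.
Variables (q : bool -> bool -> R).
Hypotheses (q_ge0 : forall z g, 0 <= q z g) (q_sum : forall z, \sum_g q z g = 1).
Local Notation s := (\sum_(z : bool) 2^-1 * q z z).

Lemma round_success01 : 0 <= s <= 1.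
Proof.
have := q_sum true; have := q_sum false; rewrite !big_bool /=.
have := q_ge0 true true; have := q_ge0 false false.
have := q_ge0 true false; have := q_ge0 false true; lra.
Qed.

(** The potential now follows the deficit [b - c - n s], bounding the probability of falling short
    by at least [t]. *)
Lemma round_weight_ge t b n c : 0 < t ->
  1 - tail t n (b - c%:R - n%:R * s) <= round_weight q n c (fun k => b - t <= k%:R).
Proof.
move=> t0; elim: n c => [|n IH] c.
  rewrite /= mul0r subr0; case: ifP => [_|/negbT].
    by rewrite gerBl tail_ge0.
  rewrite -ltNge => lt; rewrite subr_le0 tail0_ge1 //; lra.
set x := b - c%:R - n.+1%:R * s.
have tail_eq : b - c%:R - n%:R * s = x + s by rewrite /x -natr1; ring.
have tail_eq1 : b - c.+1%:R - n%:R * s = x + s - 1 by rewrite /x -!natr1; ring.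
have IH0 := IH c; have IH1 := IH c.+1; rewrite tail_eq in IH0; rewrite tail_eq1 in IH1.
(* Failure is the unit step of the deficit: it moves to [x + s - 1] after success and to [x + s]
   after failure, so [tail_step] starts at [x + s - 1] with probability [1 - s] and ends at [x]. *)
have s01 : 0 <= 1 - s <= 1 by have := round_success01; lra.
move: IH0 IH1; have := tail_step t (x + s - 1) n s01.
rewrite subrK (_ : x + s - 1 + (1 - s) = x); last by ring.
move: (tail t n (x + s)) (tail t n (x + s - 1)) (tail t n.+1 x) => T0 T1 T2.
have := q_sum true; have := q_sum false; rewrite /= !big_bool /= addn0 addn1.
move: (q_ge0 true true) (q_ge0 false false) (q_ge0 true false) (q_ge0 false true).
move: (round_weight q n c _) (round_weight q n c.+1 _) => W0 W1.
move: (q true true) (q false false) (q true false) (q false true).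
move=> q11 q00 q10 q01 q11_ge0 q00_ge0 q10_ge0 q01_ge0 sum0 sum1 step W0le W1le.
have := ler_wpM2l q01_ge0 W0le; have := ler_wpM2l q10_ge0 W0le.
have := ler_wpM2l q00_ge0 W1le; have := ler_wpM2l q11_ge0 W1le.
have -> : q01 = 1 - q00 by lra.
have -> : q10 = 1 - q11 by lra.
lra.
Qed.

Lemma round_achievable r : r < s ->
  achievable (fun n => round_weight q n 0 (fun k => r * n%:R <= k%:R)) r.
Proof.
move=> rs eps e0 m m0; have sr0 : 0 < s - r by rewrite subr_gt0.
have [m' vanish] := tail_vanishes ler01 e0 sr0.
exists (maxn m m'); split; first exact: leq_maxl.
set n := maxn m m'; have := vanish n (leq_maxr _ _); rewrite mul1r => lt_eps.
have n0 : (0 : R) < n%:R by rewrite ltr0n; apply: leq_trans m0 (leq_maxl _ _).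
have := round_weight_ge (n%:R * s) n 0 (mulr_gt0 n0 sr0).
rewrite subr0 subrr (_ : n%:R * s - n%:R * (s - r) = r * n%:R); last by ring.
by apply: le_trans; lra.
Qed.

End Rounds.

(** * Simulation of a catalytic protocol by a memory protocol *)

Section Catalysis.
Variable R : realType.
Local Notation C := (R[i]).
Local Notation Op := (@Op R).
Local Notation proto := (@proto R).
Local Notation toC := (real_complex R).

Lemma guess_probE (A B FA FB : finType) (Mz : proto bool FA FB A B) sigma g :
  psd sigma ->
  toC (guess_prob Mz sigma g) = \sum_(lf <- leaves Mz) (lf.1 == g)%:R * tr (lf.2 sigma).
Proof.
move=> psds; rewrite /guess_prob RRe_real; last first.
  apply: ger0_real; elim: (leaves_psd Mz) => [|lf s plf _ IHs]; first by rewrite big_nil.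
  rewrite big_cons; case: ifP => // _; apply: addr_ge0 => //.
  by apply: psd_tr_ge0; exact: plf.
rewrite big_mkcond; apply: eq_bigr => lf _.
by case: ifP => _; rewrite ?mul1r ?mul0r.
Qed.

Lemma guess_prob_ge0 (A B FA FB : finType) (Mz : proto bool FA FB A B) sigma g :
  psd sigma -> 0 <= guess_prob Mz sigma g.
Proof.
move=> psds; rewrite -ler0c guess_probE //.
elim: (leaves_psd Mz) => [|lf s plf _ IHs]; first by rewrite big_nil.
rewrite big_cons addr_ge0 // mulr_ge0 //.
by apply: psd_tr_ge0; exact: plf.
Qed.

Lemma guess_prob_sum (A B FA FB : finType) (Mz : proto bool FA FB A B) sigma :
  wf Mz -> density sigma -> \sum_g guess_prob Mz sigma g = 1.
Proof.
move=> wfM [psds trs]; apply: (@complexI R); rewrite rmorph_sum /= big_bool /=.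
rewrite !guess_probE // -big_split /= -[RHS]trs -(sum_leaves_tr sigma wfM).
by apply: eq_bigr => -[[] F] _ /=; ring.
Qed.

(** The history serves only to select the protocol, so a constant strategy forgets it; this lets the
    round-by-round induction restart from the empty history. *)
Lemma mem_weight_const (A B MA MB : finType) (rho0 rho1 : Op (A * B) (A * B))
    (p : proto bool MA MB (A * MA)%type (B * MB)%type) n h c M P :
  mem_weight rho0 rho1 (fun=> p) n h c M P = mem_weight rho0 rho1 (fun=> p) n [::] c M P.
Proof.
elim: n h c M => [|n IH] h c M //=.
apply: eq_bigr => z _; congr (_ * _); apply: eq_bigr => k _.
by rewrite IH [RHS]IH.
Qed.

Section Simulation.
Variables (A B CA CB FA FB : finType) (rho0 rho1 sigma0 sigma1 : Op (A * B) (A * B)).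
Variables (tau : Op (CA * CB) (CA * CB)).
Variables (Lam : proto unit (A * CA)%type (B * CB)%type (A * CA)%type (B * CB)%type)
          (Mz : proto bool FA FB A B).
Hypothesis catalytic : forall z : bool, forall i j,
  channel Lam (joint (pick_state rho0 rho1 z) tau) i j
  = joint (pick_state sigma0 sigma1 z) tau i j.
Hypotheses (dens0 : density sigma0) (dens1 : density sigma1) (dens_tau : density tau).

Definition simulation : proto bool CA CB (A * CA)%type (B * CB)%type :=
  pbind Lam (fun=> pbind (plift CA CB Mz) (fun g => @discard R bool FA FB CA CB g)).

Lemma wf_simulation : wf Lam -> wf Mz -> wf simulation.
Proof.
move=> wfL wfM; apply: wf_pbind => // _; apply: wf_pbind; first exact: wf_plift.
by move=> l; exact: wf_discard.
Qed.

Lemma linear_discard (G : bool -> Op (CA * CB) (CA * CB) -> C) l :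
  (forall g, linear_fun (G g)) ->
  linear_fun (fun X => G l (actB (discardK R FB CB) (actA (discardK R FA CA) X))).
Proof.
move=> lG; apply: (linear_fun_comp (G := fun X => actB _ (actA _ X))) => //.
by apply: linear_comp; [exact: linear_actB | exact: linear_actA].
Qed.

(** A single leaf of [Lam] need not return the catalyst; only the sum over its leaves does.
    Linearity of [G] and of the later leaf maps allows that sum to be taken first. *)
Lemma sum_leaves_simulation (G : bool -> Op (CA * CB) (CA * CB) -> C) z :
  (forall g, linear_fun (G g)) ->
  \sum_(lf <- leaves simulation) G lf.1 (lf.2 (joint (pick_state rho0 rho1 z) tau))
  = \sum_(lf <- leaves Mz) tr (lf.2 (pick_state sigma0 sigma1 z)) * G lf.1 tau.
Proof.
move=> lG; rewrite sum_leaves_pbind.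
under eq_bigr => lf _.
  rewrite sum_leaves_pbind.
  under eq_bigr => lf' _ do
    rewrite (sum_leaves_AStep G) big_seq1 (sum_leaves_BStep G) !big_seq1.
  over.
(* The sum over the leaves of [Lam] becomes the inner one, ready to be reassembled into the
   channel. *)
rewrite /= exchange_big /=.
pose H l X := G l (actB (discardK R FB CB) (actA (discardK R FA CA) X)).
transitivity (\sum_(lf <- leaves (plift CA CB Mz))
  H lf.1 (lf.2 (joint (pick_state sigma0 sigma1 z) tau))).
  apply: eq_big_Forall; elim: (leaves_linear (plift CA CB Mz)) => // lf s' lin _ IHs.
  constructor=> //.
  have -> : joint (pick_state sigma0 sigma1 z) tau
      = fun i j => \sum_(lf <- leaves Lam) 1 * lf.2 (joint (pick_state rho0 rho1 z) tau) i j.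
    by apply: OpP => i j; rewrite -catalytic; apply: eq_bigr => l _; rewrite mul1r.
  rewrite lin /H (linear_discard _ lG).
  by apply: eq_bigr => l _; rewrite mul1r.
rewrite sum_leaves_plift; apply: eq_bigr => lf _.
by rewrite /H discard_joint (linear_fun_scale _ _ (lG _)).
Qed.

(** After each round the memory is [tau] times a scalar; summed over the leaves with a given guess,
    these scalars give [guess_prob], and linearity factors them out. *)
Lemma mem_weight_simulation n c P :
  mem_weight rho0 rho1 (fun=> simulation) n [::] c tau P
  = toC (round_weight (fun z g => guess_prob Mz (pick_state sigma0 sigma1 z) g) n c P).
Proof.
elim: n c => [|n IH] c /=.
  by case: ifP => _; rewrite ?rmorph0 //; case: dens_tau.
rewrite rmorph_sum; apply: eq_bigr => z _.
rewrite rmorphM fmorphV rmorph_nat; congr (_ * _).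
under eq_bigr do rewrite mem_weight_const.
pose G g M := mem_weight rho0 rho1 (fun=> simulation) n [::] (c + (g == z)) M P.
rewrite (sum_leaves_nth simulation (false, fun _ => fun _ _ => 0)
  (fun lf => G lf.1 (lf.2 (joint (pick_state rho0 rho1 z) tau)))).
rewrite sum_leaves_simulation => [|g]; last exact: linear_mem_weight.
under [LHS]eq_bigr do rewrite /G IH.
have psd_sigma : psd (pick_state sigma0 sigma1 z).
  by case: z {G}; [case: dens1 | case: dens0].
rewrite rmorph_sum big_bool /= !rmorphM /= !guess_probE // !mulr_suml -big_split /=.
by apply: eq_bigr => -[[] F] _ /=; ring.
Qed.

End Simulation.

End Catalysis.

Theorem theorem1 (R : realType) (A B : finType)
  (rho0 rho1 : Op R (A * B) (A * B)) :
  density rho0 -> density rho1 ->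
  separable rho0 -> separable rho1 ->
  R_mem rho0 rho1 = P_LOCC rho0 rho1 /\ R_cat rho0 rho1 = P_LOCC rho0 rho1.
Proof.
move=> dens0 dens1 /separable_sepcone sep0 /separable_sepcone sep1.
rewrite /R_mem /R_cat; set Smem := (X in sup X = _ /\ _); set Scat := (X in _ /\ sup X = _).
set q := P_LOCC rho0 rho1.
have mem_le r : Smem r -> r <= q.
  move=> [_ [MA [MB [mu [strat [dmu wfs ach]]]]]].
  exact: (mem_achievable_le sep0 sep1 dens0 dens1 wfs dmu ach).
have cat_mem r : Scat r -> Smem r.
  move=> [r01 [CA [CB [tau [Lam [s0 [s1 [FA [FB [Mz H]]]]]]]]]].
  case: H => dtau wfL [ds0 ds1] [cat wfM] ach; split=> //.
  exists CA, CB, tau, (fun=> simulation Lam Mz); split=> //.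
    by move=> _; exact: wf_simulation.
  move=> eps e0 m m0; have [n [mn le]] := ach eps e0 m m0; exists n; split=> //.
  by rewrite /mem_prob (mem_weight_simulation Mz cat).
have cat_ge r : 0 <= r -> r < q -> Scat r.
  move=> r0 rq; have q1 : q <= 1 by exact: P_LOCC_le1.
  split; first by lra.
  have [FA [FB [Mz [wfM lt]]]] := success_gt dens0 dens1 rq.
  (* Trivial one-dimensional catalyst and an empty [Lam], so each [sigma] is the corresponding
     [rho]. *)
  exists unit, unit, (fun _ _ => 1), (@Stop R unit _ _ tt), rho0, rho1, FA, FB, Mz.
  split=> //.
  - split.
      by move=> v; rewrite sum_pair !sum_unit sum_pair !sum_unit mulr1 mulrC mulcJ_ge0.
    by rewrite /tr sum_pair !sum_unit.
  - by split=> // z i j; rewrite /channel big_seq1.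
  have dens z : density (pick_state rho0 rho1 z) by case: z.
  apply: round_achievable => [z g|z|].
  - by apply: guess_prob_ge0; case: (dens z).
  - exact: guess_prob_sum.
  rewrite -ltcR rmorph_sum; apply: lt_le_trans lt _; rewrite le_eqVlt; apply/orP; left.
  apply/eqP/eq_bigr => z _; rewrite rmorphM fmorphV rmorph_nat; congr (_ * _).
  by symmetry; apply: guess_probE; case: (dens z).
have q0 : 0 < q by exact: P_LOCC_gt0.
(* Rates are nonnegative, so [q - e] witnesses the lower bound only when [e < q]; otherwise rate 0
   does, which belongs to [S] because [q] is positive. *)
have sup_eq S : (forall r, S r -> r <= q) -> (forall r, 0 <= r -> r < q -> S r) -> sup S = q.
  move=> Sle Sge; apply/eqP; rewrite eq_le; apply/andP; split.
    by apply: ge_sup => //; exists 0; exact: Sge.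
  apply/ler_addgt0Pr => e e0.
  have [qe|eq] := leP q e.
    apply: le_trans qe _; rewrite lerDr; apply: ub_le_sup; first by exists q.
    exact: Sge.
  rewrite -lerBlDr; apply: ub_le_sup; first by exists q.
  by apply: Sge; lra.
split; apply: sup_eq => //.
- by move=> r r0 rq; apply: cat_mem; exact: cat_ge.
- by move=> r /cat_mem; exact: mem_le.
Qed.
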